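(* Let $k\ge2$ be an integer, $d=k-1$, let $\boldsymbol\omega\in\mathcal G_{k,\ell}$ with $\ell\ge2$ an integer, and let $\Lambda\subset\mathbb R^k$ be a unimodular lattice. Let $\phi:[1,\infty)\to[1,\infty)$ be a non-decreasing function (such that the function $L$ below is well defined) for which $$|H(\boldsymbol\lambda)\,\lambda_k|<\frac1{\phi(H(\boldsymbol\lambda))}$$ holds for infinitely many $(\boldsymbol\lambda,\lambda_k)\in\Lambda^*$ (with $\boldsymbol\lambda\in\mathbb R^d$, $\lambda_k\in\mathbb R$). Then there is a constant $c>0$, not depending on $N$, such that there exist infinitely many $N\in\mathbb N$ (with $N\ge\phi(1)$) for which $$D_{\boldsymbol\omega}(\Lambda;N)\ge c\,\phi(L(N)).$$
   Context: Notation. For $\mathbf m\in\mathbb R^d$, $H(\mathbf m)=\prod_{i\le d}\max\{1,|m_i|\}$. $e(z)=e^{2\pi i z}$ and $\widehat f(\xi)=\int_{\mathbb R}f(x)e(-\xi x)\,dx$. A lattice $\Lambda=A\mathbb Z^k$ ($A\in\mathbb R^{k\times k}$ invertible) is unimodular if $|\det A|=1$; its dual lattice is $\Lambda^*=(A^{-1})^T\mathbb Z^k$. The function $L$. For $x\ge\phi(1)$, $L(x)\in[1,x]$ denotes the value of $H$ such that $H\phi(H)=x$. (It is unique because $H\mapsto H\phi(H)$ is strictly increasing; it is assumed that it exists for every $x\ge\phi(1)$, which is the case exactly when $\phi$ is continuous.) The class $\mathcal G_{k,\ell}$. It is the set of $\boldsymbol\omega=(\omega_1,\ldots,\omega_k)$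 such that for each $i\le k$: $\omega_i:\mathbb R\to[0,\infty)$ is $\ell$ times continuously differentiable, $\mathrm{supp}(\omega_i)\subseteq[-2,2]$, $\widehat\omega_i\ge0$ everywhere, and $\widehat\omega_i(0)>0$. Smooth lattice discrepancy. Put $\mathfrak C(\boldsymbol\omega)=\widehat\omega_1(0)\cdots\widehat\omega_k(0)$. A box is a pair $\mathfrak B=(\boldsymbol\gamma;\boldsymbol\rho)$ with $\boldsymbol\gamma\in\mathbb R^d$, $\boldsymbol\rho\in(0,1/2)^d$, and $\mathrm{vol}(\mathfrak B;N)=\rho_1\cdots\rho_dN$. Define $$D^\Lambda_{\boldsymbol\omega}(\mathfrak B;N)=\sum_{(\boldsymbol\lambda,\lambda_k)\in\Lambda}\omega_k\Big(\frac{\lambda_k}{N}\Big)\prod_{i\le d}\omega_i\Big(\frac{\lambda_i-\gamma_i}{\rho_i}\Big)-\mathfrak C(\boldsymbol\omega)\,\mathrm{vol}(\mathfrak B;N)$$ and $D_{\boldsymbol\omega}(\Lambda;N)=\sup_{\mathfrak B}|D^\Lambda_{\boldsymbol\omega}(\mathfrak B;N)|$, the supremum being over all boxes $\mathfrak B=(\boldsymbol\gamma;\boldsymbol\rho)$ with $\boldsymbol\gamma\in\mathbb R^d$ and $\boldsymbol\rho\in(0,1/2)^d$. *)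

(* Defs.v *)
From HB Require Import structures.
From mathcomp Require Import all_boot all_order all_algebra.
From mathcomp Require Import all_classical all_reals all_analysis.
From mathcomp Require Import complex.

Set Implicit Arguments.
Unset Strict Implicit.
Unset Printing Implicit Defensive.
Import Order.TTheory GRing.Theory Num.Theory.
Import numFieldNormedType.Exports.
Local Open Scope classical_set_scope.
Local Open Scope ring_scope.
Local Open Scope complex_scope.

(* The dimension k >= 2 is written d.+1 with d >= 1. *)

Section Fourier.
Variable R : realType.
Implicit Types (f : R -> R) (F : R -> R[i]).

(* e(z) = exp(2 pi i z) *)
Definition expi (z : R) : R[i] := cos (2 * pi * z) +i* sin (2 * pi * z).

Definition cintegral F : R[i] :=
  (\int[lebesgue_measure]_x complex.Re (F x))
    +i* (\int[lebesgue_measure]_x complex.Im (F x)).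

Definition fourier f (xi : R) : R[i] :=
  cintegral (fun x => (f x)%:C * expi (- (xi * x))).

Definition continuously_differentiable (l : nat) f : Prop :=
  (forall j, (j < l)%N -> forall x : R, derivable (derive1n j f) x 1) /\
  continuous (derive1n l f).

(* In the order of R[i], 0 <= z means that z is real and nonnegative. *)
Definition classG (k l : nat) (w : 'I_k -> R -> R) : Prop :=
  forall i : 'I_k,
    [/\ forall x, 0 <= w i x,
        continuously_differentiable l (w i),
        closure [set x | w i x != 0] `<=` `[-2, 2],
        forall xi, 0 <= fourier (w i) xi
      & 0 < fourier (w i) 0].

(* The numbers fourier (w i) 0 are real when w is in classG. *)
Definition constC (k : nat) (w : 'I_k -> R -> R) : R :=
  \prod_(i < k) complex.Re (fourier (w i) 0).

End Fourier.

Section Lattice.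
Variable R : realType.

Definition lattice (k : nat) (A : 'M[R]_k) : set 'cV[R]_k :=
  [set A *m map_mx intr z | z in [set: 'cV[int]_k]].

Definition unimodular_basis (k : nat) (A : 'M[R]_k) : Prop :=
  A \in unitmx /\ `|\det A| = 1.

Definition dual_lattice (k : nat) (A : 'M[R]_k) : set 'cV[R]_k :=
  lattice (invmx A)^T.

Variable d : nat.

(* A vector of R^(d+1) is the pair (head v, last v) of R^d * R. *)
Definition vhead (v : 'cV[R]_d.+1) : 'cV[R]_d :=
  \col_(i < d) v (widen_ord (leqnSn d) i) 0.
Definition vlast (v : 'cV[R]_d.+1) : R := v ord_max 0.

Definition height (m : 'cV[R]_d) : R := \prod_(i < d) Num.max 1 `|m i 0|.

End Lattice.

(* The solution H in [1, x] of H * phi H = x; the value 1 is used only when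
   there is none. *)
Definition Lphi (R : realType) (phi : R -> R) (x : R) : R :=
  xget 1 [set H | 1 <= H <= x /\ H * phi H = x].

Section Discrepancy.
Variables (R : realType) (d : nat).
Variables (w : 'I_d.+1 -> R -> R) (A : 'M[R]_d.+1) (N : nat).
Implicit Types gamma rho : 'cV[R]_d.

Definition box_vol rho : R := (\prod_(i < d) rho i 0) * N%:R.

Definition box_weight gamma rho (v : 'cV[R]_d.+1) : R :=
  w ord_max (vlast v / N%:R) *
  \prod_(i < d)
    w (widen_ord (leqnSn d) i) ((vhead v i 0 - gamma i 0) / rho i 0).

(* The terms of the lattice sum are nonnegative when w is in classG, so that
   esum, the supremum of the finite partial sums, is the sum. *)
Definition box_discrepancy gamma rho : \bar R :=
  (\esum_(v in lattice A) (box_weight gamma rho v)%:E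
    - (constC w * box_vol rho)%:E)%E.

Definition discrepancy : \bar R :=
  ereal_sup [set `|box_discrepancy b.1 b.2|%E | b in
    [set b : 'cV[R]_d * 'cV[R]_d | forall i, 0 < b.2 i 0 < 1 / 2]].

End Discrepancy.

(* Main.v *)
Require Import Defs.
From HB Require Import structures.
From mathcomp Require Import all_boot all_order all_algebra.
From mathcomp Require Import all_classical all_reals all_analysis.
From mathcomp Require Import complex ring lra.
From mathcomp Require Import zify.
Import Order.TTheory GRing.Theory Num.Theory.
Import numFieldNormedType.Exports.
Local Open Scope classical_set_scope.
Local Open Scope ring_scope.

(** Write [F] for the product of the [w i (v i 0 / s i)], where the scales [s]
    are the sides of the box and [N], and [S g] for the sum of [F (v - g)] over
    the lattice. Poisson summation expands [S g] over the dual lattice with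
    coefficients the Fourier transform of [F], which is nonnegative, times the
    characters e(- xi . g). Hence, for every dual vector [xi],
      2 S 0 - S g - S (- g)  >=  4 F^(xi)   as soon as   xi . g = 1/2.
    When the last coordinate of [g] vanishes, the three sums belong to three
    boxes of the same volume, so their main terms cancel and the left-hand side
    is at most four times the discrepancy. A dual vector [xi] of height H > 1
    has a coordinate of modulus above 1 besides the last one, which allows such
    a [g]; let moreover |H * last xi| < 1 / phi H. For the sides
    1 / (32 max (1, |xi i|)) and N = floor (H phi H / 32) all the products
    [s i * xi i] have modulus at most 1/32, so that F^(xi) is of the order of
    the product of the scales, that is N / H, or phi H. Finally L N <= H since
    N <= H phi H, so phi (L N) <= phi H. Heights are unbounded on the given
    infinite set, because the lattice is discrete; hence infinitely many [N]
    arise.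

    The inequality above is proved, up to a constant factor, by working with
    finite sets of lattice points. The average of the second difference over
    translates by the cube [0, n)^k of the lattice is n ^ (- k) times a
    quadratic form
      sum over a, b of  p a * p b * F (x a - x b),   p a = 1 or -1.
    In one coordinate, a function with nonnegative Fourier transform is, on a
    long enough interval of length [P], the limit of its Fejer means of period
    [P]; all terms being nonnegative, one of them may be kept and the others
    dropped ([fourier_coef_le]). Doing so coordinate after coordinate
    ([exp_sum_le]) bounds the form below by the product of the coefficients
    fourier_cos (w i) (h i / P i) / P i times the square of one exponential
    sum over the points. The periods [P i] are of the size n / s i of the point
    set; choosing [h i / P i] within 1 / P i of [s i * xi i] moves no phase by
    more than 1/8, so that the exponential sum is still at least n ^ k, which
    gives n ^ k times the product of the scales ([cube_second_diff_ge]).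
    Letting n grow turns the averages into lattice sums
    ([lattice_second_diff_ge]). *)

(** * The Fejer kernel *)

(** The double sum, [n] times the usual kernel, is the form in which Fejer means
    of products of transforms appear below. *)
Definition fejer {R : realType} (n : nat) (t : R) : R :=
  \sum_(j < n) \sum_(l < n) cos ((j%:R - l%:R) * t).

Lemma fejer_sq {R : realType} (n : nat) (t : R) :
  fejer n t = (\sum_(j < n) cos (j%:R * t)) ^+ 2
            + (\sum_(j < n) sin (j%:R * t)) ^+ 2.
Proof.
rewrite /fejer !expr2 !mulr_suml -big_split; apply: eq_bigr => j _.
rewrite /= !mulr_sumr -big_split; apply: eq_bigr => l _.
by rewrite /= mulrBl cosB.
Qed.

Lemma fejer_ge0 {R : realType} (n : nat) (t : R) : 0 <= fejer n t.
Proof. by rewrite fejer_sq addr_ge0 ?sqr_ge0. Qed.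

(** The real and imaginary parts of (1 - e^(i t)) * sum of the e^(i j t), which
    telescopes to 1 - e^(i n t). *)
Lemma dirichlet_sumE {R : realType} (n : nat) (t : R) :
  let C := \sum_(j < n) cos (j%:R * t) in
  let S := \sum_(j < n) sin (j%:R * t) in
  C * (1 - cos t) + S * sin t = 1 - cos (n%:R * t) /\
  S * (1 - cos t) - C * sin t = - sin (n%:R * t).
Proof.
elim: n => [|n [IC IS]].
  by rewrite /= !big_ord0 !mul0r cos0 sin0 subrr subr0 oppr0 addr0.
rewrite /= !big_ord_recr /=.
have -> : n.+1%:R * t = n%:R * t + t by rewrite -natr1 mulrDl mul1r.
rewrite cosD sinD.
move: IC IS => /=; set C := \sum_(i < n) _; set S := \sum_(i < n) _.
by split; nra.
Qed.

(** The bound does not depend on [n] although the kernel has total mass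
    [n * P]: away from the multiples of the period the normalized kernel tends
    to 0. *)
Lemma fejer_tail_le {R : realType} (n : nat) (t : R) :
  (1 - cos t) * fejer n t <= 2.
Proof.
have [] := dirichlet_sumE n t; rewrite /= fejer_sq.
set C := \sum_(i < n) _; set S := \sum_(i < n) _ => h1 h2.
have e1 := cos2Dsin2 t; have e2 := cos2Dsin2 (n%:R * t).
have := cos_geN1 (n%:R * t).
suff : (1 - cos t) * (C ^+ 2 + S ^+ 2) = 1 - cos (n%:R * t) by lra.
have : (C * (1 - cos t) + S * sin t) ^+ 2 + (S * (1 - cos t) - C * sin t) ^+ 2
  = 2 * ((1 - cos t) * (C ^+ 2 + S ^+ 2)).
  have -> : (C * (1 - cos t) + S * sin t) ^+ 2
    + (S * (1 - cos t) - C * sin t) ^+ 2 =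
     (C ^+ 2 + S ^+ 2) * (1 - 2 * cos t + (cos t ^+ 2 + sin t ^+ 2)) by ring.
  by rewrite e1; ring.
rewrite h1 h2 => h3.
have : (1 - cos (n%:R * t)) ^+ 2 + (- sin (n%:R * t)) ^+ 2
  = 1 - 2 * cos (n%:R * t) + (cos (n%:R * t) ^+ 2 + sin (n%:R * t) ^+ 2) by
    ring.
rewrite h3 e2; lra.
Qed.

(** * Integrals over a period *)

Lemma continuous_integrable_itv {R : realType} (f : R -> R) (a b : R) :
  continuous f ->
  (@lebesgue_measure R).-integrable `[a, b] (EFin \o f).
Proof.
move=> cf; apply: continuous_compact_integrable; first exact: segment_compact.
exact: continuous_subspaceT.
Qed.

Lemma measurable_segment {R : realType} (a b : R) :
  measurable (`[a, b]%classic : set R).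
Proof. exact: measurable_itv. Qed.

Lemma Rintegral_itv_sum {R : realType} (I : Type) (r : seq I)
    (f : I -> R -> R) (a b : R) : (forall i, continuous (f i)) ->
  \int[lebesgue_measure]_(x in `[a, b]) (\sum_(i <- r) f i x) =
  \sum_(i <- r) \int[lebesgue_measure]_(x in `[a, b]) f i x.
Proof.
move=> cf; elim: r => [|i r IH].
  rewrite big_nil (eq_Rintegral _ (g := cst 0)); last first.
    by move=> x _; rewrite big_nil.
  by rewrite Rintegral_cst ?mul0r //; exact: measurable_segment.
rewrite big_cons -IH -RintegralD; first last.
- apply: continuous_integrable_itv => x.
  by apply: (continuous_big add_continuous) => j _; exact: cf.
- exact: continuous_integrable_itv.
- exact: measurable_segment.
by apply: eq_Rintegral => x _; rewrite big_cons.
Qed.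

Lemma continuous_cos_lin {R : realType} (a b : R) :
  continuous (fun x : R => cos (a * (x - b))).
Proof.
move=> x; apply: (@continuous_comp _ _ _ (fun x : R => a * (x - b)) cos).
  apply: cvgM; first exact: cvg_cst.
  by apply: cvgB; [exact: cvg_id|exact: cvg_cst].
exact: continuous_cos.
Qed.

Lemma continuous_sin_lin {R : realType} (a b : R) :
  continuous (fun x : R => sin (a * (x - b))).
Proof.
move=> x; apply: (@continuous_comp _ _ _ (fun x : R => a * (x - b)) sin).
  apply: cvgM; first exact: cvg_cst.
  by apply: cvgB; [exact: cvg_id|exact: cvg_cst].
exact: continuous_sin.
Qed.

Lemma cosD2pi_int {R : realType} (m : int) (x : R) :
  cos (x + 2 * pi * m%:~R) = cos x.
Proof.
have h (n : nat) (y : R) : cos (y + 2 * pi * n%:R) = cos y.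
  rewrite -[RHS](periodicn (@cosD2pi R) n y).
  by rewrite -(mulr_natl pi 2) -(mulr_natr (2 * pi) n).
case: m => n; first exact: h.
by rewrite NegzE mulrNz mulrN -(h n.+1) -addrA addNr addr0.
Qed.

Lemma sinD2pi_int {R : realType} (m : int) (x : R) :
  sin (x + 2 * pi * m%:~R) = sin x.
Proof. by rewrite -!cosBpihalf addrAC cosD2pi_int. Qed.

(** The sine primitive takes the same value at both ends of a period. *)
Lemma Rintegral_cos_period {R : realType} (P u : R) (m : int) :
  0 < P -> m != 0 ->
  \int[lebesgue_measure]_(x in `[u - P / 2, u + P / 2])
     cos (m%:~R * (2 * pi / P) * (x - u)) = 0.
Proof.
move=> P0 m0; set a : R := m%:~R * (2 * pi / P).
have pi0 := @pi_gt0 R.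
have a0 : a != 0.
  by rewrite mulf_neq0 ?intr_eq0 // gt_eqF // divr_gt0 // mulr_gt0.
pose F x := a^-1 * sin (a * (x - u)).
have dF (x : R) : is_derive x 1 F (cos (a * (x - u))).
  rewrite /F; apply: is_derive_eq.
  by rewrite /GRing.scale /=; field.
have cF : continuous F.
  by move=> x; apply: cvgM; [exact: cvg_cst|exact: continuous_sin_lin].
rewrite /Rintegral (@continuous_FTC2 _ _ F).
- rewrite -EFinB /= /F.
  have -> : u + P / 2 - u = P / 2 by ring.
  have -> : u - P / 2 - u = - (P / 2) by ring.
  have -> : a * (P / 2) = m%:~R * pi by rewrite /a; field; rewrite gt_eqF.
  have -> : a * - (P / 2) = - (m%:~R * pi) by rewrite /a; field; rewrite gt_eqF.
  rewrite -(sinD2pi_int m (- _)).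
  have -> : - (m%:~R * pi) + 2 * pi * m%:~R = m%:~R * pi :> R by ring.
  by rewrite subrr.
- by rewrite ltrD2l; lra.
- by apply: continuous_subspaceT; exact: continuous_cos_lin.
- split.
  + by move=> x _; apply: ex_derive.
  + by apply: cvg_at_right_filter; exact: cF.
  + by apply: cvg_at_left_filter; exact: cF.
- by move=> x _; rewrite derive1E; apply: derive_val.
Qed.

(** * Fejer means of a function with nonnegative Fourier transform *)

Definition fourier_cos {R : realType} (f : R -> R) (t : R) : R :=
  \int[lebesgue_measure]_x (f x * cos (2 * pi * t * x)).
Definition fourier_sin {R : realType} (f : R -> R) (t : R) : R :=
  \int[lebesgue_measure]_x (f x * sin (2 * pi * t * x)).

(** The Fourier transform of [f] at [t] is
    [fourier_cos f t - i * fourier_sin f t]; the last two clauses say that it is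
    real and nonnegative. *)
Definition pos_fourier_bump {R : realType} (f : R -> R) : Prop :=
  [/\ continuous f, forall x, 2 < `|x| -> f x = 0,
      forall t, 0 <= fourier_cos f t & forall t, fourier_sin f t = 0].

Lemma fejer_mul_diff {R : realType} (n : nat) (t : R) : fejer n t =
  \sum_(j < n) \sum_(l < n) cos ((j%:Z - l%:Z)%:~R * t).
Proof.
by apply: eq_bigr => j _; apply: eq_bigr => l _; rewrite intrB -!pmulrn.
Qed.

Lemma continuous_sum {R : realType} (I : Type) (r : seq I) (f : I -> R -> R) :
  (forall i, continuous (f i)) -> continuous (fun x => \sum_(i <- r) f i x).
Proof. by move=> cf; apply: (continuous_big add_continuous). Qed.

Lemma continuous_fejer {R : realType} (n : nat) (a b : R) :
  continuous (fun x => fejer n (a * (x - b))).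
Proof.
apply: continuous_sum => j; apply: continuous_sum => l x.
under eq_fun do rewrite mulrA.
exact: continuous_cos_lin.
Qed.

(** Only the diagonal terms have a nonzero mean over a period. *)
Lemma Rintegral_fejer {R : realType} (n : nat) (P u : R) : 0 < P ->
  \int[lebesgue_measure]_(x in `[u - P / 2, u + P / 2])
     fejer n (2 * pi / P * (x - u)) = n%:R * P.
Proof.
move=> P0.
under eq_Rintegral do rewrite fejer_mul_diff.
rewrite Rintegral_itv_sum; last first.
  move=> j; apply: continuous_sum => l x.
  under eq_fun do rewrite mulrA.
  exact: continuous_cos_lin.
rewrite (eq_bigr (fun=> P)); first by rewrite sumr_const card_ord mulr_natl.
move=> j _; rewrite Rintegral_itv_sum; last first.
  move=> l x.
  under eq_fun do rewrite mulrA.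
  exact: continuous_cos_lin.
rewrite (bigD1 j) //= big1 ?addr0 => [|l lj].
  rewrite (eq_Rintegral _ (g := cst 1)); last first.
    by move=> x _; rewrite subrr mul0r cos0.
  rewrite Rintegral_cst ?mul1r; last exact: measurable_segment.
  have := @lebesgue_measure_itv R `[u - P / 2, u + P / 2]; rewrite /= => ->.
  rewrite lte_fin ifT; last by rewrite ltrD2l; lra.
  by rewrite -EFinB /=; field.
under eq_Rintegral do rewrite mulrA.
apply: Rintegral_cos_period => //.
by rewrite subr_eq0; apply: contra lj => /eqP[/ord_inj ->].
Qed.

Lemma Rintegral_supp {R : realType} (f : R -> R) (a b : R) :
  (forall x, x \notin `[a, b] -> f x = 0) ->
  \int[lebesgue_measure]_x f x = \int[lebesgue_measure]_(x in `[a, b]) f x.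
Proof.
move=> f0; rewrite [RHS]Rintegral_mkcond; apply: eq_Rintegral => x _.
rewrite patchE; case: ifPn => // /negP h; apply: f0.
by apply/negP => h'; apply: h; rewrite inE.
Qed.

(** Since the sine transform vanishes, shifting [f] only multiplies its cosine
    transform by a cosine. The condition on [P] makes the period centred at [u]
    contain the support of [f]. *)
Lemma fourier_cos_shift {R : realType} (f : R -> R) (P u t : R) :
  pos_fourier_bump f -> 2 * (`|u| + 2) <= P ->
  \int[lebesgue_measure]_(x in `[u - P / 2, u + P / 2])
     (f x * cos (2 * pi * t * (x - u))) =
  fourier_cos f t * cos (2 * pi * t * u).
Proof.
case=> cf supp _ sin0 hP.
have fz g x : x \notin `[u - P / 2, u + P / 2] -> f x * g x = 0.
  move=> hx; rewrite supp ?mul0r // ltNge; apply: contra hx.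
  rewrite in_itv /= ler_norml => /andP[h1 h2].
  by have := ler_norm u; have := lerNnormlW (lexx `|u|); lra.
have -> : fourier_cos f t * cos (2 * pi * t * u) =
  fourier_cos f t * cos (2 * pi * t * u)
    + fourier_sin f t * sin (2 * pi * t * u).
  by rewrite sin0 mul0r addr0.
rewrite /fourier_cos /fourier_sin (Rintegral_supp _ (u - P / 2) (u + P / 2));
  last exact: fz.
rewrite (Rintegral_supp _ (u - P / 2) (u + P / 2)); last exact: fz.
have ci (g : R -> R) : continuous g ->
  lebesgue_measure.-integrable `[u - P / 2, u + P / 2]
     (EFin \o (fun x => f x * g x)).
  move=> cg; apply: continuous_integrable_itv => x.
  by apply: cvgM; [exact: cf|exact: cg].
have cc : continuous (fun x : R => cos (2 * pi * t * x)).
  by move=> x; have := @continuous_cos_lin R (2 * pi * t) 0 x;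
     under eq_fun do rewrite subr0.
have cs : continuous (fun x : R => sin (2 * pi * t * x)).
  by move=> x; have := @continuous_sin_lin R (2 * pi * t) 0 x;
     under eq_fun do rewrite subr0.
rewrite -!RintegralZr; [|exact: measurable_segment|exact: ci
  |exact: measurable_segment|exact: ci].
rewrite -RintegralD; [|exact: measurable_segment| |].
- by apply: eq_Rintegral => x _; rewrite mulrBr cosB mulrDr !mulrA.
- apply: continuous_integrable_itv => x; apply: cvgM; last exact: cvg_cst.
  by apply: cvgM; [exact: cf|exact: cc].
- apply: continuous_integrable_itv => x; apply: cvgM; last exact: cvg_cst.
  by apply: cvgM; [exact: cf|exact: cs].
Qed.

(** The Fejer sum of the Fourier coefficients of [f] is the convolution of [f]
    with the Fejer kernel. *)
Lemma fejer_sum_integral {R : realType} (f : R -> R) (P u : R) (n : nat) :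
  pos_fourier_bump f -> 0 < P -> 2 * (`|u| + 2) <= P ->
  \sum_(j < n) \sum_(l < n)
    fourier_cos f ((j%:R - l%:R) / P) * cos (2 * pi * ((j%:R - l%:R) / P) * u) =
  \int[lebesgue_measure]_(x in `[u - P / 2, u + P / 2])
     (f x * fejer n (2 * pi / P * (x - u))).
Proof.
move=> af P0 hP; have [cf _ _ _] := af.
have cg (a : R) : continuous (fun x => f x * cos (a * (x - u))).
  by move=> x; apply: cvgM; [exact: cf|exact: continuous_cos_lin].
under [RHS]eq_Rintegral do (rewrite /fejer mulr_sumr;
  under eq_bigr do rewrite mulr_sumr;
    under eq_bigr do under eq_bigr do rewrite mulrA).
rewrite Rintegral_itv_sum; last by move=> j; apply: continuous_sum.
apply: eq_bigr => j _; rewrite Rintegral_itv_sum //.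
apply: eq_bigr => l _; rewrite -(@fourier_cos_shift _ f P) //.
apply: eq_Rintegral => x _; congr (_ * cos (_ * _)).
by field; rewrite gt_eqF.
Qed.

Lemma pos_fourier_bump_bounded {R : realType} (f : R -> R) :
  pos_fourier_bump f -> exists2 B, 0 < B & forall x, `|f x| <= B.
Proof.
case=> cf supp _ _.
have le22 : (-2 : R) <= 2 by lra.
have cnf : {within `[-2, 2], continuous (fun x : R => `|f x|)}.
  apply: continuous_subspaceT => x.
  by apply: (@continuous_comp _ _ _ f); [exact: cf|exact: norm_continuous].
have [c _ hc] := EVT_max le22 cnf.
exists (`|f c| + 1); first by rewrite ltr_wpDl.
move=> x; case: (ltP 2 `|x|) => hx.
  by rewrite supp // normr0 addr_ge0.
rewrite (le_trans (hc x _)) ?lerDl //.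
by rewrite in_itv /= -ler_norml.
Qed.

(** A form of continuity at [u] which integrates well against the Fejer kernel:
    the oscillation is measured by 1 - cos, and [fejer_tail_le] bounds the
    product of the kernel with that function. Near [u] the term [e] suffices;
    away from [u] the function 1 - cos is bounded below and [f] is bounded. *)
Lemma continuity_cos_modulus {R : realType} (f : R -> R) (P u e : R) :
  pos_fourier_bump f -> 0 < P -> 0 < e ->
  exists2 M, 0 <= M & forall x, x \in `[u - P / 2, u + P / 2] ->
    `|f x - f u| <= e + M * (1 - cos (2 * pi / P * (x - u))).
Proof.
move=> af P0 e0; have [B B0 hB] := pos_fourier_bump_bounded _ af.
have [cf _ _ _] := af.
have /cvgrPdist_le /(_ e e0) /nbhs_ballP[d /= d0 hd] := cf u.
(* within half a period the function 1 - cos is monotone in the distance *)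
pose d' := Num.min (d / 2) (P / 2).
have d'0 : 0 < d' by rewrite lt_min !divr_gt0.
have pi0 := @pi_gt0 R.
pose a := 2 * pi / P; have a0 : 0 < a by rewrite divr_gt0 // mulr_gt0.
have api (y : R) : 0 <= y -> y <= P / 2 -> a * y \in `[0, pi].
  move=> y0 yP; rewrite in_itv /= mulr_ge0 ?(ltW a0) //=.
  have -> : pi = a * (P / 2) :> R by rewrite /a; field; rewrite gt_eqF.
  by rewrite ler_wpM2l // ltW.
have d'P : d' <= P / 2 by rewrite ge_min lexx orbT.
have P2 : 0 <= P / 2 by rewrite divr_ge0 // ltW.
have cd : 0 < 1 - cos (a * d').
  rewrite subr_gt0 -[ltRHS]cos0 ltr_cos ?api ?(ltW d'0) ?(mulr_gt0 a0 d'0) //.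
  by rewrite in_itv /= lexx pi_ge0.
rewrite -/a; exists (2 * B / (1 - cos (a * d'))).
  by rewrite divr_ge0 ?(ltW cd) // mulr_ge0 // ltW.
move=> x; rewrite in_itv /= => /andP[x1 x2].
have hc0 : 0 <= 1 - cos (a * (x - u)) by rewrite subr_ge0 cos_le1.
case: (ltP `|x - u| d') => hx.
  have h : `|f u - f x| <= e.
    apply: hd; rewrite /ball /= distrC.
    by move: hx; rewrite lt_min => /andP[h1 _]; rewrite (lt_trans h1) //; lra.
  rewrite distrC (le_trans h) //.
  by rewrite lerDl mulr_ge0 // divr_ge0 ?(ltW cd) // mulr_ge0 // ltW.
apply: (@le_trans _ _ (2 * B)).
  by rewrite (le_trans (ler_normB _ _)) // mulr_natl mulr2n lerD.
apply: ler_wpDl; first exact: ltW.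
rewrite -mulrA -[leLHS]mulr1; apply: ler_wpM2l;
  first by rewrite mulr_ge0 // ltW.
rewrite mulrC ler_pdivlMr // mul1r lerD2l lerN2.
have -> : cos (a * (x - u)) = cos (a * `|x - u|).
  by case: (ger0P (x - u)) => // _; rewrite mulrN cosN.
rewrite leNgt ltr_cos ?api ?(ltW d'0) ?normr_ge0 //; last first.
  by rewrite ler_norml; lra.
by rewrite -leNgt ler_wpM2l // ltW.
Qed.

(** Fejer's theorem at [u]. The kernel is nonnegative of mass [n * P], so the
    error is at most the [e] of [continuity_cos_modulus] plus O(1 / n). *)
Lemma fejer_cvg {R : realType} (f : R -> R) (P u : R) :
  pos_fourier_bump f -> 0 < P -> 2 * (`|u| + 2) <= P ->
  (n.+1%:R * P)^-1 * (\sum_(j < n.+1) \sum_(l < n.+1)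
    fourier_cos f ((j%:R - l%:R) / P) * cos (2 * pi * ((j%:R - l%:R) / P) * u))
  @[n --> \oo] --> f u.
Proof.
move=> af P0 hP; apply/cvgrPdist_le => e e0.
have [M M0 hM] := continuity_cos_modulus f P u (e / 2) af P0
  (divr_gt0 e0 (ltr0Sn _ 1)).
near=> n.
rewrite fejer_sum_integral //; set a := 2 * pi / P;
  set D := `[u - P / 2, u + P / 2]%classic.
have [cf _ _ _] := af.
have nP0 : 0 < n.+1%:R * P by rewrite mulr_gt0.
have cK := continuous_fejer n.+1 a u.
have cg : continuous (fun x => f x * fejer n.+1 (a * (x - u))).
  by move=> x; apply: cvgM; [exact: cf|exact: cK].
have ccu : continuous (fun x => f u * fejer n.+1 (a * (x - u))).
  by move=> x; apply: cvgM; [exact: cvg_cst|exact: cK].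
have cd : continuous (fun x => f x * fejer n.+1 (a * (x - u))
    - f u * fejer n.+1 (a * (x - u))).
  by move=> x; apply: cvgB; [exact: cg|exact: ccu].
have mD : measurable D by exact: measurable_segment.
pose J := \int[lebesgue_measure]_(x in D) (f x * fejer n.+1 (a * (x - u))).
have eJ : J - f u * (n.+1%:R * P) = \int[lebesgue_measure]_(x in D)
    (f x * fejer n.+1 (a * (x - u)) - f u * fejer n.+1 (a * (x - u))).
  rewrite RintegralB //; [|exact: continuous_integrable_itv
     |exact: continuous_integrable_itv].
  rewrite RintegralZl //; last exact: continuous_integrable_itv.
  by rewrite Rintegral_fejer.
have bJ : `|J - f u * (n.+1%:R * P)| <= e / 2 * (n.+1%:R * P) + 2 * M * P.
  rewrite eJ.
  apply: le_trans (le_normr_Rintegral _ _) _ => //.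
    exact: continuous_integrable_itv.
  have -> : e / 2 * (n.+1%:R * P) + 2 * M * P = \int[lebesgue_measure]_(x in D)
     (e / 2 * fejer n.+1 (a * (x - u)) + 2 * M).
    rewrite RintegralD //; first last.
    - by apply: continuous_integrable_itv => x; exact: cvg_cst.
    - by apply: continuous_integrable_itv => x; apply: cvgM;
      [exact: cvg_cst|exact: cK].
    rewrite RintegralZl //; last exact: continuous_integrable_itv.
    rewrite Rintegral_fejer // Rintegral_cst //.
    have := @lebesgue_measure_itv R `[u - P / 2, u + P / 2]; rewrite /= => ->.
    rewrite lte_fin ifT; last by rewrite ltrD2l; lra.
    by rewrite -EFinB /=; congr (_ + _ * _); field.
  apply: le_Rintegral => //.
  - apply: continuous_integrable_itv => x.
    by apply: (@continuous_comp _ _ _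
      (fun x => f x * fejer n.+1 (a * (x - u)) - f u * fejer n.+1
        (a * (x - u)))); [exact: cd|exact: norm_continuous].
  - apply: continuous_integrable_itv => x; apply: cvgD; last exact: cvg_cst.
    by apply: cvgM; [exact: cvg_cst|exact: cK].
  move=> x xD; rewrite -mulrBl normrM (ger0_norm (fejer_ge0 _ _)).
  apply: le_trans (ler_wpM2r (fejer_ge0 _ _) (hM x xD)) _.
  have := ler_wpM2l M0 (fejer_tail_le n.+1 (a * (x - u))).
  by rewrite mulrA mulrDl lerD2l (mulrC M 2).
have -> : f u - (n.+1%:R * P)^-1 * J =
    - ((n.+1%:R * P)^-1 * (J - f u * (n.+1%:R * P))).
  by rewrite mulrBr mulrCA mulVf ?gt_eqF // mulr1 opprB.
rewrite normrN normrM gtr0_norm ?invr_gt0 // mulrC ler_pdivrMr //.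
apply: le_trans bJ _.
rewrite -lerBrDl -mulrBl (_ : e - e / 2 = e / 2); last by field.
rewrite (mulrA (e / 2)); apply: ler_wpM2r; first exact: ltW.
rewrite (mulrC (e / 2)) -ler_pdivrMr ?divr_gt0 // -(natr1 n) ler_wpDr //;
  near: n; exact: nbhs_infty_ger.
Unshelve. all: by end_near.
Qed.

(** The difference [h] is realized by at least n - 2 |h| pairs: every [l] with
    |h| <= l < n - |h| can be completed. *)
Lemma diff_sum_ge {R : realType} (g : int -> R) (h : int) (n : nat) :
  (forall z, 0 <= g z) ->
  (n%:R - 2 * `|h|%N%:R) * g h <= \sum_(j < n) \sum_(l < n) g (j%:Z - l%:Z).
Proof.
move=> g0; set m := `|h|%N; rewrite exchange_big /=.
have G0 (l : nat) : 0 <= \sum_(j < n) g (j%:Z - l%:Z) by apply: sumr_ge0.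
case: (leqP (2 * m) n) => hn; last first.
  apply: (@le_trans _ _ 0); last by apply: sumr_ge0.
  by rewrite mulr_le0_ge0 // subr_le0 -natrM ler_nat ltnW.
rewrite -(big_mkord xpredT (fun l : nat => \sum_(j < n) g (j%:Z - l%:Z))).
rewrite (@big_cat_nat _ _ _ m) //=; last by lia.
rewrite (@big_cat_nat _ _ _ (n - m) m) //=; [|lia|lia].
rewrite ler_wpDl ?sumr_ge0 // ler_wpDr ?sumr_ge0 //.
have -> : (n%:R - 2 * m%:R) * g h = \sum_(m <= l < n - m) g h.
  rewrite sumr_const_nat -[RHS]mulr_natl -natrM -natrB //.
  by congr (_%:R * _); lia.
rewrite !big_nat; apply: ler_sum => l /andP[l1 l2].
have hj : (absz (l%:Z + h)%R < n)%N by lia.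
rewrite (bigD1 (Ordinal hj)) //= (_ : g _ = g h);
  first by rewrite lerDl sumr_ge0.
by congr g; lia.
Qed.

(** The right-hand side is the limit of the Fejer means of the products of the
    coefficients of [f] with [E]. All these products are nonnegative, so keeping
    only the frequency [h / P], whose Fejer weight tends to 1, gives a lower
    bound. The sine part of [E] contributes nothing because the coefficients of
    [f] are even. *)
Lemma fourier_coef_le {R : realType} (f : R -> R) (P : R) (h : int)
    (I : finType) (a b u : I -> R) :
  let E t := \sum_i (a i * cos (2 * pi * t * u i)
                     + b i * sin (2 * pi * t * u i)) in
  pos_fourier_bump f -> 0 < P -> (forall i, 2 * (`|u i| + 2) <= P) ->
  (forall t, 0 <= E t) ->
  fourier_cos f (h%:~R / P) / P * E (h%:~R / P) <= \sum_i a i * f (u i).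
Proof.
move=> E af P0 hP E0; have [_ _ W0 _] := af.
pose t (j l : nat) : R := (j%:R - l%:R) / P.
pose T n : R :=
  \sum_(j < n.+1) \sum_(l < n.+1) fourier_cos f (t j l) * E (t j l).
(* exchanging j and l changes the sign of the sine and keeps the coefficient *)
have odd0 n v : \sum_(j < n) \sum_(l < n)
    fourier_cos f (t j l) * sin (2 * pi * t j l * v) = 0.
  set X := \sum_(j < n) _.
  have : X = - X.
    rewrite {1}/X exchange_big -sumrN; apply: eq_bigr => j _.
    rewrite -sumrN; apply: eq_bigr => l _; rewrite -mulrN -sinN.
    have -> : t l j = - t j l by rewrite /t -mulNr opprB.
    congr (_ * _); last by congr sin; rewrite mulrN mulNr.
    by apply: eq_Rintegral => x _; rewrite mulrN mulNr cosN.
  by move=> h0; lra.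
have TE n : (n.+1%:R * P)^-1 * T n = \sum_i a i * ((n.+1%:R * P)^-1 *
    (\sum_(j < n.+1) \sum_(l < n.+1)
      fourier_cos f (t j l) * cos (2 * pi * t j l * u i))).
  under [RHS]eq_bigr do rewrite mulrCA.
  rewrite -mulr_sumr; congr (_ * _).
  transitivity (\sum_i (
      a i * (\sum_(j < n.+1) \sum_(l < n.+1)
        fourier_cos f (t j l) * cos (2 * pi * t j l * u i))
    + b i * (\sum_(j < n.+1) \sum_(l < n.+1)
        fourier_cos f (t j l) * sin (2 * pi * t j l * u i)))); last first.
    by apply: eq_bigr => i _; rewrite odd0 mulr0 addr0.
  rewrite /T.
  under eq_bigr do under eq_bigr do rewrite /E mulr_sumr.
  under eq_bigr do rewrite exchange_big /=.
  rewrite exchange_big /=; apply: eq_bigr => i _.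
  rewrite !mulr_sumr -big_split; apply: eq_bigr => j _.
  rewrite /= !mulr_sumr -big_split; apply: eq_bigr => l _ /=; ring.
have cT : (n.+1%:R * P)^-1 * T n @[n --> \oo] --> \sum_i a i * f (u i).
  under eq_fun do rewrite TE.
  apply: (cvg_big add_continuous) => i _.
  apply: cvgM; first exact: cvg_cst.
  exact: fejer_cvg.
pose c := fourier_cos f (h%:~R / P) / P * E (h%:~R / P).
have cL : (1 - 2 * `|h|%N%:R * (n.+1%:R)^-1) * c @[n --> \oo] --> c.
  rewrite -[X in _ --> X]mul1r; apply: cvgM; last exact: cvg_cst.
  rewrite -[X in _ --> X]subr0; apply: cvgB; first exact: cvg_cst.
  rewrite -[X in _ --> X](mulr0 (2 * `|h|%N%:R)); apply: cvgM;
    first exact: cvg_cst.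
  exact: cvg_harmonic.
apply: (ler_cvg_to cL cT); near=> n.
have := @diff_sum_ge R (fun z => fourier_cos f (z%:~R / P) * E (z%:~R / P)) h
  n.+1 _.
move=> /(_ (fun z => mulr_ge0 (W0 _) (E0 _))) hd.
rewrite [leRHS]mulrC ler_pdivlMr ?mulr_gt0 //.
have -> : T n = \sum_(j < n.+1) \sum_(l < n.+1)
   fourier_cos f ((j%:Z - l%:Z)%:~R / P) * E ((j%:Z - l%:Z)%:~R / P).
  apply: eq_bigr => j _; apply: eq_bigr => l _.
  by rewrite intrB -!pmulrn.
apply: le_trans hd.
rewrite /c le_eqVlt; apply/orP; left; apply/eqP.
have : n.+1%:R != 0 :> R by rewrite pnatr_eq0.
move: (fourier_cos f _) (E _) (n.+1%:R) => x y z z0; field.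
by rewrite z0 gt_eqF.
Unshelve. all: by end_near.
Qed.

(** * Lower bounds for quadratic forms *)

(** With [c a = p a + i * q a], the left-hand side contains the squared modulus
    of the sum of the c a * e^(i phase a), and the right-hand side is the
    Hermitian form of the [c a] attached to the product of the [f i]. One
    coordinate [i] is treated by [fourier_coef_le], where the form in the
    other coordinates, with [c a] rotated by 2 pi t (y i a), plays the role of
    [E t] and is nonnegative by induction. *)
Lemma exp_sum_le {R : realType} (K : Type) (I : finType) (f : K -> R -> R)
    (P : K -> R) (h : K -> int) (y : K -> I -> R) (r : seq K) (p q : I -> R) :
  let phase a := \sum_(i <- r) 2 * pi * ((h i)%:~R / P i) * y i a in
  (forall i, pos_fourier_bump (f i)) -> (forall i, 0 < P i) ->
  (forall i a b, 2 * (`|y i a - y i b| + 2) <= P i) ->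
  \prod_(i <- r) (fourier_cos (f i) ((h i)%:~R / P i) / P i) *
   ((\sum_a (p a * cos (phase a) - q a * sin (phase a))) ^+ 2 +
    (\sum_a (p a * sin (phase a) + q a * cos (phase a))) ^+ 2)
  <= \sum_a \sum_b (p a * p b + q a * q b) * \prod_(i <- r) f i (y i a - y i b).
Proof.
move=> phase af P0 hP; rewrite /phase {phase}.
elim: r p q => [|i r IH] p q.
  rewrite big_nil mul1r.
  rewrite [X in X ^+ 2 + _](eq_bigr p); last first.
    by move=> a _; rewrite big_nil cos0 sin0 mulr1 mulr0 subr0.
  rewrite [X in _ + X ^+ 2](eq_bigr q); last first.
    by move=> a _; rewrite big_nil cos0 sin0 mulr1 mulr0 add0r.
  rewrite !expr2 !mulr_suml -big_split /=.
  apply: ler_sum => a _; rewrite !mulr_sumr -big_split;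
    apply: ler_sum => b _ /=.
  by rewrite big_nil mulr1.
pose F a b := \prod_(j <- r) f j (y j a - y j b).
pose pt t a := p a * cos (2 * pi * t * y i a) - q a * sin (2 * pi * t * y i a).
pose qt t a := p a * sin (2 * pi * t * y i a) + q a * cos (2 * pi * t * y i a).
have W0 j t : 0 <= fourier_cos (f j) t by case: (af j).
have prod0 : 0 <= \prod_(j <- r) (fourier_cos (f j) ((h j)%:~R / P j) / P j).
  by apply: prodr_ge0 => j _; rewrite divr_ge0 // ltW.
pose E t := \sum_a \sum_b (pt t a * pt t b + qt t a * qt t b) * F a b.
have E0 t : 0 <= E t.
  by apply: le_trans (IH _ _); rewrite mulr_ge0 // addr_ge0 // sqr_ge0.
have := @fourier_coef_le R (f i) (P i) (h i) (prod I I)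
  (fun c => (p c.1 * p c.2 + q c.1 * q c.2) * F c.1 c.2)
  (fun c => (p c.1 * q c.2 - q c.1 * p c.2) * F c.1 c.2)
  (fun c => y i c.1 - y i c.2) (af i) (P0 i) (fun c => hP i c.1 c.2).
rewrite /= => /(_ _).
have EE t : \sum_(c : I * I) ((p c.1 * p c.2 + q c.1 * q c.2) * F c.1 c.2 *
    cos (2 * pi * t * (y i c.1 - y i c.2)) +
    (p c.1 * q c.2 - q c.1 * p c.2) * F c.1 c.2 *
    sin (2 * pi * t * (y i c.1 - y i c.2))) = E t.
  rewrite /E pair_bigA /=; apply: eq_bigr => -[a b] _ /=.
  by rewrite mulrBr cosB sinB /pt /qt; ring.
rewrite EE => H.
have {}H := H (fun t => etrans (congr1 (fun z => 0 <= z) (EE t)) (E0 t)).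
have -> : \sum_a \sum_b (p a * p b + q a * q b) *
    \prod_(j <- i :: r) f j (y j a - y j b) = \sum_(c : I * I)
   (p c.1 * p c.2 + q c.1 * q c.2) * F c.1 c.2 * f i (y i c.1 - y i c.2).
  rewrite pair_bigA /=; apply: eq_bigr => -[a b] _ /=.
  by rewrite big_cons -mulrA [in RHS](mulrC (F a b)).
apply: le_trans H.
rewrite big_cons -mulrA; apply: ler_wpM2l; first by rewrite divr_ge0 // ltW.
apply: le_trans (IH _ _).
apply: ler_wpM2l => //.
rewrite le_eqVlt; apply/orP; left; apply/eqP; congr (_ ^+ 2 + _ ^+ 2);
  by apply: eq_bigr => a _; rewrite big_cons cosD sinD /pt /qt; ring.
Qed.

Lemma cos_sum_le {R : realType} (K : Type) (I : finType) (f : K -> R -> R)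
    (P : K -> R) (h : K -> int) (y : K -> I -> R) (r : seq K) (p : I -> R) :
  (forall i, pos_fourier_bump (f i)) -> (forall i, 0 < P i) ->
  (forall i a b, 2 * (`|y i a - y i b| + 2) <= P i) ->
  \prod_(i <- r) (fourier_cos (f i) ((h i)%:~R / P i) / P i) *
   (\sum_a p a * cos (\sum_(i <- r) 2 * pi * ((h i)%:~R / P i) * y i a)) ^+ 2
  <= \sum_a \sum_b p a * p b * \prod_(i <- r) f i (y i a - y i b).
Proof.
move=> af P0 hP.
have := @exp_sum_le R K I f P h y r p (fun=> 0) af P0 hP.
rewrite /= => H.
under [leRHS]eq_bigr do under eq_bigr do rewrite -[p _ * p _]addr0
  -[X in _ + X](mul0r 0).
apply: le_trans H; apply: ler_wpM2l.
  by apply: prodr_ge0 => j _; rewrite divr_ge0 ?(ltW (P0 _)) //; case: (af j).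
rewrite [X in _ <= X ^+ 2 + _](_ : _ = \sum_a p a *
  cos (\sum_(i <- r) 2 * pi * ((h i)%:~R / P i) * y i a)).
  by rewrite lerDl sqr_ge0.
by apply: eq_bigr => a _; rewrite mul0r subr0.
Qed.

(** * The second difference averaged over a cube of lattice points *)

Lemma cos_ge_half {R : realType} (y : R) : `|y| <= pi / 4 -> 1 / 2 <= cos y.
Proof.
rewrite ler_norml => /andP[y1 y2].
have pi0 := @pi_gt0 R.
have c0 : 0 <= cos y by apply: cos_ge0_pihalf; apply/andP; lra.
have : 0 <= cos (y + y) by apply: cos_ge0_pihalf; apply/andP; lra.
rewrite cosD => h; have := cos2Dsin2 y; nra.
Qed.

(** On the support |x| <= 2 the phase 2 pi t x has modulus at most pi / 4. *)
Lemma fourier_cos_ge_half {R : realType} (f : R -> R) (t : R) :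
  pos_fourier_bump f -> (forall x, 0 <= f x) -> `|t| <= 1 / 16 ->
  fourier_cos f 0 / 2 <= fourier_cos f t.
Proof.
case=> cf supp _ _ f0 ht.
have fz g x : x \notin `[-2, 2] -> f x * g x = 0.
  move=> hx; rewrite supp ?mul0r // ltNge; apply: contra hx.
  by rewrite in_itv /= ler_norml.
have ci a : (@lebesgue_measure R).-integrable `[-2, 2]
     (EFin \o (fun x => f x * cos (a * x))).
  apply: continuous_integrable_itv => x; apply: cvgM; first exact: cf.
  by have := @continuous_cos_lin R a 0 x; under eq_fun do rewrite subr0.
have mD : measurable (`[-2, 2]%classic : set R) by exact: measurable_segment.
rewrite /fourier_cos (Rintegral_supp _ (-2) 2); last exact: fz.
rewrite (Rintegral_supp _ (-2) 2); last exact: fz.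
rewrite -RintegralZr //; apply: le_Rintegral => //.
  apply: continuous_integrable_itv => x; apply: cvgM; last exact: cvg_cst.
  apply: cvgM; first exact: cf.
  by have := @continuous_cos_lin R (2 * pi * 0) 0 x;
    under eq_fun do rewrite subr0.
move=> x; rewrite /= in_itv /= -ler_norml => hx.
rewrite mulr0 mul0r cos0 mulr1; apply: ler_wpM2l => //.
rewrite -[leLHS]mul1r; apply: cos_ge_half.
have pi0 := @pi_gt0 R.
rewrite -[2 * pi * t]mulrA !normrM (ger0_norm (ltW pi0))
  (ger0_norm (ler0n _ 2)).
have : `|t| * `|x| <= 1 / 16 * 2 by apply: ler_pM.
have : 0 <= `|t| * `|x| by rewrite mulr_ge0.
nra.
Qed.

Definition lattice_pt {R : realType} {k : nat} (A : 'M[R]_k)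
    (m : 'cV[int]_k) : 'cV[R]_k :=
  A *m map_mx intr m.

Definition cube_pt {k n : nat} (z : {ffun 'I_k -> 'I_n}) : 'cV[int]_k :=
  \col_i (z i)%:Z.

(** The summand 1 leaves room for a translation by a vector with entries at
    most 1 ([lattice_pt_cube_le] bounds the lattice part by
    [(entry_bound A - 1) * n]). *)
Definition entry_bound {R : realType} {k : nat} (A : 'M[R]_k) : R :=
  (\sum_i \sum_j `|A i j|) + 1.

(** The periods used below are [period_cst A * n / s i]. The first summand keeps
    the total phase error at most 1/8; the other two make the period longer than
    all differences of points and keep 1 / P at most 1/32. *)
Definition period_cst {R : realType} {k : nat} (A : 'M[R]_k) : R :=
  8 * k%:R * entry_bound A + 4 * entry_bound A + 32.

Lemma entry_bound_ge1 {R : realType} {k : nat} (A : 'M[R]_k) : 1 <= entry_bound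
  A.
Proof.
by rewrite /entry_bound lerDr; apply: sumr_ge0 => i _; apply: sumr_ge0.
Qed.

Lemma lattice_pt_cube_le {R : realType} {k n : nat} (A : 'M[R]_k)
  (z : {ffun 'I_k -> 'I_n}) i :
  `|lattice_pt A (cube_pt z) i 0| <= (entry_bound A - 1) * n%:R.
Proof.
apply: (@le_trans _ _ ((\sum_j `|A i j|) * n%:R)); last first.
  rewrite ler_wpM2r // /entry_bound addrK [leRHS](bigD1 i) //= lerDl.
  by apply: sumr_ge0 => j _; apply: sumr_ge0.
rewrite mxE; apply: (le_trans (ler_norm_sum _ _ _)).
rewrite mulr_suml; apply: ler_sum => j _.
rewrite normrM ler_wpM2l // !mxE -pmulrn normr_nat ler_nat.
exact: ltnW.
Qed.

Lemma lattice_ptB {R : realType} {k : nat} (A : 'M[R]_k) (m m' : 'cV[int]_k) :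
  lattice_pt A (m - m') = lattice_pt A m - lattice_pt A m'.
Proof. by rewrite /lattice_pt map_mxB mulmxBr. Qed.

Lemma lattice_pt_inj {R : realType} {k : nat} (A : 'M[R]_k) : A \in unitmx ->
  injective (lattice_pt A).
Proof.
move=> Au m m' /(congr1 (mulmx (invmx A))); rewrite !mulKmx // => /matrixP h.
by apply/matrixP => i j; have := h i j; rewrite !mxE => /intr_inj.
Qed.

Definition scaled_weight {R : realType} {k : nat} (w : 'I_k -> R -> R)
    (s : 'I_k -> R) (v : 'cV[R]_k) : R := \prod_i w i (v i 0 / s i).

(** The points are the A z and A z + g with [z] in the cube, with signs 1 and
  -1.
    Since xi . (A z) is an integer and xi . g = 1/2, the characters at [xi]
    agree with the signs, and the exponential sum of [cos_sum_le] at
    frequencies close to the [s i * xi i] has no cancellation. *)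
Lemma cube_second_diff_ge {R : realType} (k n : nat) (w : 'I_k -> R -> R)
    (A : 'M[R]_k) (g xi : 'cV[R]_k) (s : 'I_k -> R) :
  let F := scaled_weight w s in
  (forall i, pos_fourier_bump (w i)) -> (forall i x, 0 <= w i x) ->
  (0 < n)%N ->
  (forall i, 0 < s i <= n%:R) ->
  (forall i, `|s i * xi i 0| <= 1 / 32) ->
  (forall m, exists j : int, \sum_i xi i 0 * lattice_pt A m i 0 = j%:~R) ->
  \sum_i xi i 0 * g i 0 = 1 / 2 ->
  (forall i, `|g i 0| <= 1) ->
  \prod_i (fourier_cos (w i) 0 / (2 * period_cst A)) * (\prod_i s i)
    * n%:R ^+ k <=
  \sum_(z : {ffun 'I_k -> 'I_n}) \sum_(z' : {ffun 'I_k -> 'I_n})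
   (2 * F (lattice_pt A (cube_pt z - cube_pt z'))
     - F (lattice_pt A (cube_pt z - cube_pt z') + g)
     - F (lattice_pt A (cube_pt z - cube_pt z') - g)).
Proof.
move=> F aw w0 n0 hs hxi hint hg hg1.
set C := period_cst A; set M := entry_bound A.
have M1 : 1 <= M by exact: entry_bound_ge1.
have kM : 0 <= k%:R * M by rewrite mulr_ge0 //; lra.
have hC : C = 8 * (k%:R * M) + 4 * M + 32 by rewrite /C /period_cst mulrA.
have C0 : 0 < C by rewrite hC; nra.
have nR : 1 <= n%:R :> R by rewrite ler1n.
have n0R : 0 < n%:R :> R by rewrite ltr0n.
have s0 i : 0 < s i by case/andP: (hs i).
pose Z := {ffun 'I_k -> 'I_n}.
pose x (a : Z * bool) : 'cV[R]_k :=
  lattice_pt A (cube_pt a.1) + (a.2 : nat)%:R *: g.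
pose y i (a : Z * bool) : R := x a i 0 / s i.
pose P i : R := C * n%:R / s i.
pose h i : int := Num.floor (P i * (s i * xi i 0)).
pose p (a : Z * bool) : R := (-1) ^+ a.2.
have P0 i : 0 < P i by rewrite divr_gt0 // mulr_gt0.
have xle a i : `|x a i 0| <= M * n%:R.
  rewrite /x mxE; apply: (le_trans (ler_normD _ _)).
  have -> : M * n%:R = (M - 1) * n%:R + n%:R by ring.
  apply: lerD; first exact: lattice_pt_cube_le.
  apply: le_trans nR; rewrite mxE normrM; case: a.2 => /=.
    by rewrite normr1 mul1r.
  by rewrite normr0 mul0r.
have yle a i : `|y i a| <= M * n%:R / s i.
  by rewrite /y normrM (gtr0_norm (_ : 0 < (s i)^-1)) ?invr_gt0 // ler_pM2r
    ?invr_gt0.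
have sinv i : 1 <= n%:R / s i.
  by rewrite ler_pdivlMr // mul1r; case/andP: (hs i).
have hP i a b : 2 * (`|y i a - y i b| + 2) <= P i.
  have := yle a i; have := yle b i; have := ler_normB (y i a) (y i b).
  have := sinv i.
  have -> : M * n%:R / s i = M * (n%:R / s i) by rewrite mulrA.
  rewrite /P -mulrA; set N := n%:R / s i => N1 h1 h2 h3; rewrite hC.
  have : 0 <= k%:R * M * N by rewrite mulr_ge0 //; lra.
  nra.
have herr i : `|(h i)%:~R / P i - s i * xi i 0| <= (P i)^-1.
  have := floor_itv (P i * (s i * xi i 0));
    rewrite -/(h i) intrD => /andP[h1 h2].
  have -> : (h i)%:~R / P i - s i * xi i 0 =
      ((h i)%:~R - P i * (s i * xi i 0)) / P i.
    by rewrite mulrBl [P i * _]mulrC mulfK // gt_eqF.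
  rewrite normrM (gtr0_norm (_ : 0 < (P i)^-1)) ?invr_gt0 //.
  rewrite ler_piMl ?invr_ge0 ?(ltW (P0 i)) //.
  by rewrite ler_norml; move: h1 h2; rewrite /=; lra.
have hPinv i : (P i)^-1 <= 1 / 32.
  rewrite div1r lef_pV2 ?posrE //; rewrite /P -mulrA hC.
  by have := sinv i; nra.
have hW i : fourier_cos (w i) 0 / 2 <= fourier_cos (w i) ((h i)%:~R / P i).
  apply: fourier_cos_ge_half => //.
  have := ler_normD ((h i)%:~R / P i - s i * xi i 0) (s i * xi i 0).
  rewrite subrK; have := herr i; have := hPinv i; have := hxi i; lra.
have := @cos_sum_le R 'I_k (Z * bool)%type w P h y (index_enum 'I_k) p aw P0 hP.
have -> : \sum_a \sum_b p a * p b * \prod_(i <- index_enum 'I_k)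
    w i (y i a - y i b) = \sum_(z : Z) \sum_(z' : Z)
   (2 * F (lattice_pt A (cube_pt z - cube_pt z'))
     - F (lattice_pt A (cube_pt z - cube_pt z') + g)
     - F (lattice_pt A (cube_pt z - cube_pt z') - g)).
  have wF a b : \prod_(i <- index_enum 'I_k) w i (y i a - y i b) =
      F (lattice_pt A (cube_pt a.1 - cube_pt b.1)
         + ((a.2 : nat)%:R - (b.2 : nat)%:R) *: g).
    apply: eq_bigr => i _; rewrite /y -mulrBl; congr (w i (_ / _)).
    by rewrite lattice_ptB /x !mxE; ring.
  rewrite -(pair_bigA _ (fun z e => \sum_b p (z, e) * p b *
    \prod_(i <- index_enum 'I_k) w i (y i (z, e) - y i b))) /=.
  apply: eq_bigr => z _.
  rewrite big_bool /= -!(pair_bigA _ (fun z' e => p (z, _) * p (z', e) *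
    \prod_(i <- index_enum 'I_k) w i (y i (z, _) - y i (z', e)))) /=.
  rewrite -big_split; apply: eq_bigr => z' _ /=.
  rewrite !big_bool /= !wF /p /= !subrr subr0 sub0r scale0r addr0 scale1r
    scaleN1r.
  by rewrite expr0 expr1; ring.
apply: le_trans.
have prodle :
    \prod_i (fourier_cos (w i) 0 / (2 * C)) * (\prod_i s i) / n%:R ^+ k <=
    \prod_(i <- index_enum 'I_k) (fourier_cos (w i) ((h i)%:~R / P i) / P i).
  rewrite -big_split /= -[in X in _ / X](card_ord k) -prodr_const -prodfV
    -big_split /=.
  apply: ler_prod => i _; have [_ _ W0 _] := aw i.
  rewrite !mulr_ge0 ?invr_ge0 ?mulr_ge0 ?(ltW C0) ?(ltW (s0 _)) //=.
  have -> : fourier_cos (w i) 0 / (2 * C) * s i / n%:R =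
      fourier_cos (w i) 0 / 2 / P i.
    by rewrite /P; field; rewrite !gt_eqF.
  by rewrite ler_pM2r ?invr_gt0.
have sumle : n%:R ^+ k <= \sum_a p a *
    cos (\sum_(i <- index_enum 'I_k) 2 * pi * ((h i)%:~R / P i) * y i a).
  have term a : 1 / 2 <= p a *
    cos (\sum_(i <- index_enum 'I_k) 2 * pi * ((h i)%:~R / P i) * y i a).
    have [j hj] := hint (cube_pt a.1).
    (* total phase error from replacing s i * xi i 0 by h i / P i *)
    pose dl := \sum_i ((h i)%:~R / P i - s i * xi i 0) * y i a.
    have -> : \sum_(i <- index_enum 'I_k) 2 * pi * ((h i)%:~R / P i) * y i a =
       2 * pi * dl + (a.2 : nat)%:R * pi + 2 * pi * j%:~R.
      have -> : (a.2 : nat)%:R * pi = 2 * pi * ((a.2 : nat)%:R * (1 / 2)) :> R.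
        by field.
      rewrite -hg -hj /dl !mulr_sumr -!big_split; apply: eq_bigr => i _ /=.
      have xE :
          x a i 0 = lattice_pt A (cube_pt a.1) i 0 + (a.2 : nat)%:R * g i 0.
        by rewrite /x mxE [X in _ + X]mxE.
      rewrite /y xE; field.
      by rewrite !gt_eqF.
    rewrite cosD2pi_int.
    have -> : p a * cos (2 * pi * dl + (a.2 : nat)%:R * pi) = cos (2 * pi * dl).
      rewrite /p; case: a.2 => /=.
        by rewrite mul1r cosDpi expr1 mulN1r opprK.
      by rewrite mul0r addr0 expr0 mul1r.
    apply: cos_ge_half.
    have dle : `|dl| <= 1 / 8.
      apply: (@le_trans _ _ (\sum_(i < k) M / C)).
        apply: (le_trans (ler_norm_sum _ _ _)); apply: ler_sum => i _.
        rewrite normrM (_ : M / C = (P i)^-1 * (M * n%:R / s i)).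
          by apply: ler_pM.
        by rewrite /P; field; rewrite !gt_eqF.
      rewrite sumr_const card_ord -(mulr_natl (M / C)) mulrA ler_pdivrMr // hC;
        lra.
    have pi0 := @pi_gt0 R.
    rewrite !normrM (ger0_norm (ltW pi0)) (ger0_norm (ler0n _ 2)).
    nra.
  apply: (@le_trans _ _ (\sum_(a : Z * bool) (1 / 2))); last exact: ler_sum.
  rewrite sumr_const card_prod card_bool card_ffun !card_ord
    -(mulr_natl (1 / 2)) natrM natrX.
  by rewrite le_eqVlt; apply/orP; left; apply/eqP; field.
have nk0 : 0 < n%:R ^+ k :> R by rewrite exprn_gt0.
apply: (@le_trans _ _ (\prod_i (fourier_cos (w i) 0 / (2 * C)) * (\prod_i s i)
    / n%:R ^+ k * (n%:R ^+ k) ^+ 2)).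
  by rewrite expr2 mulrA divfK ?gt_eqF.
apply: ler_pM => //.
- apply: divr_ge0; last exact: ltW.
  rewrite mulr_ge0 // prodr_ge0 // => i _; last exact: ltW.
  by have [_ _ W0 _] := aw i; rewrite divr_ge0 // mulr_ge0 // ltW.
- by rewrite ler_sqr ?nnegrE // ?(ltW nk0) // (le_trans (ltW nk0)).
Qed.

(** * From cubes to sums over the lattice *)

Lemma esum_inj_le {R : realType} (T : choiceType) (S : set T) (a : T -> R)
    (I : finType) (v : I -> T) (U : R) :
  injective v -> (forall i, S (v i)) ->
  (\esum_(x in S) (a x)%:E <= U%:E)%E -> \sum_i a (v i) <= U.
Proof.
move=> vi vS hU; rewrite -lee_fin; apply: le_trans hU.
apply: esum_ge; exists [set` [seq v i | i <- index_enum I]].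
  split; first exact: finite_seq.
  by move=> x /= /mapP[i _ ->].
rewrite -fsbig_seq; last by rewrite map_inj_uniq // index_enum_uniq.
by rewrite big_map -sumEFin.
Qed.

Lemma esum_gt_seq {R : realType} (T : choiceType) (S : set T) (a : T -> R)
    (L : R) :
  (L%:E < \esum_(x in S) (a x)%:E)%E ->
  exists r : seq T,
    [/\ uniq r, forall x, x \in r -> S x & L < \sum_(x <- r) a x].
Proof.
move=> /ereal_sup_gt[_ [X [Xf XS] <-]].
rewrite fsbig_finite // sumEFin lte_fin => hL.
exists (finmap.enum_fset (fset_set X)); split;
  [exact: finmap.fset_uniq| |exact: hL].
by move=> x; rewrite in_fset_set // inE; exact: XS.
Qed.

Lemma card_inner_cube_ge {k n m : nat} : (2 * m <= n)%N ->
  ((n - 2 * m) ^ k <=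
   #|ffun_on (fun j : 'I_n => (m <= j < n - m)%N) :
     {pred {ffun 'I_k -> 'I_n}}|)%N.
Proof.
move=> hn; rewrite card_ffun_on card_ord.
case: k => [|k]; first by rewrite !expn0.
rewrite leq_exp2r // -sum1_card.
rewrite -(big_mkord (fun j => (m <= j < n - m)%N) (fun=> 1%N)).
rewrite (@big_cat_nat _ _ _ m) //=; last by lia.
rewrite (@big_cat_nat _ _ _ (n - m) m) //=; [|lia|lia].
have -> : (\sum_(m <= j < n - m | m <= j < n - m) 1 = n - 2 * m)%N.
  by rewrite -big_nat sum_nat_const_nat muln1; lia.
by rewrite addnCA leq_addr.
Qed.

Lemma absz_shift (a : int) (b : nat) : (absz a <= b)%N ->
  (absz (a + b%:Z)%R)%:Z - b%:Z = a.
Proof. lia. Qed.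

Lemma absz_shift_le (a : int) (b m : nat) : (absz a <= m)%N ->
  (absz (a + b%:Z)%R <= b + m)%N.
Proof. lia. Qed.

(** Points [z'] of the cube at distance at least [m] from its boundary see
    all of [r] among the differences [cube_pt z - cube_pt z']. *)
Lemma translate_sum_ge {R : realType} (k n m : nat) (G : 'cV[int]_k -> R)
    (r : seq 'cV[int]_k) :
  (forall u, 0 <= G u) -> uniq r -> (2 * m <= n)%N ->
  (forall u i, u \in r -> (absz (u i 0%R) <= m)%N) ->
  (n - 2 * m)%:R ^+ k * \sum_(u <- r) G u <=
  \sum_(z : {ffun 'I_k -> 'I_n}) \sum_(z' : {ffun 'I_k -> 'I_n})
    G (cube_pt z - cube_pt z').
Proof.
move=> G0 ur hn hr; rewrite exchange_big /=.
pose A : {pred {ffun 'I_k -> 'I_n}} :=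
  ffun_on (fun j : 'I_n => (m <= j < n - m)%N).
apply: (@le_trans _ _ (\sum_(z' in A) \sum_(u <- r) G u)).
  rewrite sumr_const -[leRHS]mulr_natl; apply: ler_wpM2r; first exact: sumr_ge0.
  by rewrite -natrX ler_nat; exact: card_inner_cube_ge.
apply: (@le_trans _ _ (\sum_(z' in A) \sum_(z : {ffun 'I_k -> 'I_n})
    G (cube_pt z - cube_pt z'))); last first.
  by rewrite [leRHS](bigID (mem A)) /= lerDl sumr_ge0 // => z' _;
    exact: sumr_ge0.
apply: ler_sum => z' /ffun_onP hz'.
(* the cube point z' + u; the default value is not reached for u in r *)
pose t (u : 'cV[int]_k) : {ffun 'I_k -> 'I_n} :=
  [ffun i => insubd (z' i) (absz (u i 0 + (z' i)%:Z))].
have tE u : u \in r -> cube_pt (t u) - cube_pt z' = u.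
  move=> ru; apply/matrixP => i j; rewrite !mxE ffunE ord1.
  have := hr u i ru; have /andP[h1 h2] := hz' i => h3.
  rewrite val_insubd ifT; last first.
    apply: leq_ltn_trans (absz_shift_le _ _ _ h3) _.
    by rewrite addnC -ltn_subRL.
  by apply: absz_shift; exact: leq_trans h3 h1.
have ut : uniq [seq t u | u <- r].
  rewrite map_inj_in_uniq // => u u' ru ru' e.
  by rewrite -(tE u ru) -(tE u' ru') e.
have -> : \sum_(u <- r) G u =
    \sum_(z <- [seq t u | u <- r]) G (cube_pt z - cube_pt z').
  rewrite big_map; rewrite !big_seq; apply: eq_bigr => u ru.
  by rewrite tE.
rewrite big_uniq //= [leRHS](bigID (mem [seq t u | u <- r])) /= lerDl.
exact: sumr_ge0.
Qed.

Lemma esum_lattice_gt {R : realType} (k : nat) (A : 'M[R]_k) (a : 'cV[R]_k -> R)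
    (L : R) : (L%:E < \esum_(v in lattice A) (a v)%:E)%E ->
  exists (r : seq 'cV[int]_k) (m0 : nat), [/\ uniq r,
    forall u i, u \in r -> (absz (u i 0%R) <= m0)%N &
    L < \sum_(u <- r) a (lattice_pt A u)].
Proof.
move=> /esum_gt_seq[r [ur rl hL]].
have /choice[q hq] (v : 'cV[R]_k) : exists u, v \in r -> lattice_pt A u = v.
  case: (boolP (v \in r)) => [/rl[u _ <-]|_]; last by exists 0.
  by exists u.
exists [seq q v | v <- r],
  (\max_(u <- [seq q v | v <- r]) \max_i absz (u i 0%R)).
split.
- rewrite map_inj_in_uniq // => v v' vr v'r e.
  by rewrite -(hq v vr) -(hq v' v'r) e.
- move=> u i ur'; apply: leq_trans
  (leq_bigmax (F := fun j => absz (u j 0%R)) i) _.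
  exact: (@leq_bigmax_seq _ _ xpredT
    (fun u : 'cV[int]_k => \max_i absz (u i 0%R)) u ur').
- rewrite big_map (_ : \sum_(j <- r) _ = \sum_(v <- r) a v) //.
  by rewrite !big_seq; apply: eq_bigr => v vr; rewrite hq.
Qed.

Lemma cube_pt_inj {k n : nat} : injective (@cube_pt k n).
Proof.
move=> z z' /matrixP e; apply/ffunP => i; apply/ord_inj.
by have := e i 0; rewrite !mxE => -[].
Qed.

Lemma pow_shrink_cvg {R : realType} (m k : nat) :
  (1 - 2 * m%:R * (n.+1%:R)^-1 : R) ^+ k @[n --> \oo] --> (1 : R).
Proof.
have h : (1 - 2 * m%:R * (n.+1%:R)^-1 : R) @[n --> \oo] --> (1 : R).
  rewrite -[X in _ --> X]subr0; apply: cvgB; first exact: cvg_cst.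
  rewrite -[X in _ --> X](mulr0 (2 * m%:R)); apply: cvgM; first exact: cvg_cst.
  exact: cvg_harmonic.
have := cvg_comp _ _ h (@exprn_continuous R k 1).
by rewrite expr1n.
Qed.

(** The sum of [F] over the differences of cube points is at most n ^ k copies
    of the full lattice sum, while each shifted sum is at least (n - 2 m) ^ k
    copies of any given finite partial sum, where [m] bounds its coordinates;
    the quotient of these powers tends to 1. *)
Lemma lattice_second_diff_ge {R : realType} (k : nat) (w : 'I_k -> R -> R)
    (A : 'M[R]_k) (g xi : 'cV[R]_k) (s : 'I_k -> R) (U L1 L2 : R) :
  let F := scaled_weight w s in
  A \in unitmx ->
  (forall i, pos_fourier_bump (w i)) -> (forall i x, 0 <= w i x) ->
  (forall i, 0 < s i) ->
  (forall i, `|s i * xi i 0| <= 1 / 32) ->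
  (forall m, exists j : int, \sum_i xi i 0 * lattice_pt A m i 0 = j%:~R) ->
  \sum_i xi i 0 * g i 0 = 1 / 2 ->
  (forall i, `|g i 0| <= 1) ->
  (\esum_(v in lattice A) (F v)%:E <= U%:E)%E ->
  (L1%:E < \esum_(v in lattice A) (F (v + g))%:E)%E ->
  (L2%:E < \esum_(v in lattice A) (F (v - g))%:E)%E ->
  \prod_i (fourier_cos (w i) 0 / (2 * period_cst A)) * (\prod_i s i)
    <= 2 * U - L1 - L2.
Proof.
move=> F Au aw w0 s0 hxi hint hg hg1 hU.
move=> /(esum_lattice_gt _ _ (fun v => F (v + g)))[r1 [m1 [ur1 hm1 hL1]]].
move=> /(esum_lattice_gt _ _ (fun v => F (v - g)))[r2 [m2 [ur2 hm2 hL2]]].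
have F0 v : 0 <= F v by apply: prodr_ge0.
set S1 := \sum_(u <- r1) _ in hL1; set S2 := \sum_(u <- r2) _ in hL2.
pose m := maxn m1 m2.
set c := \prod_i _ * _.
(* the averaged inequality, divided by n ^ k *)
have main n : (2 * m <= n.+1)%N -> (forall i, s i <= n.+1%:R) ->
    c <= 2 * U - (1 - 2 * m%:R * (n.+1%:R)^-1) ^+ k * (S1 + S2).
  move=> hm hs.
  have := @cube_second_diff_ge R k n.+1 w A g xi s aw w0 (ltn0Sn n) _ hxi hint
    hg hg1.
  move=> /(_ (fun i => introT andP (conj (s0 i) (hs i)))); rewrite -/F -/c.
  (* z determines the difference, so no lattice point is counted twice *)
  have sub0 (z' : {ffun 'I_k -> 'I_n.+1}) :
      \sum_(z : {ffun 'I_k -> 'I_n.+1})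
        F (lattice_pt A (cube_pt z - cube_pt z')) <= U.
    apply: (@esum_inj_le _ _ (lattice A) F _
      (fun z => lattice_pt A (cube_pt z - cube_pt z'))) => //.
      by move=> z1 z2 /(lattice_pt_inj A Au) /addIr /cube_pt_inj.
    by move=> z; exists (cube_pt z - cube_pt z').
  have b0 : \sum_(z : {ffun 'I_k -> 'I_n.+1}) \sum_(z' : {ffun 'I_k -> 'I_n.+1})
      F (lattice_pt A (cube_pt z - cube_pt z')) <= n.+1%:R ^+ k * U.
    rewrite exchange_big /=.
    apply: le_trans (ler_sum _ (fun z' _ => sub0 z')) _.
    by rewrite sumr_const card_ffun !card_ord -natrX mulr_natl.
  have b1 := @translate_sum_ge R k n.+1 m (fun u => F (lattice_pt A u + g)) r1
    (fun u => F0 _) ur1 hm (fun u i ur => leq_trans (hm1 u i ur)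
      (leq_maxl _ _)).
  have b2 := @translate_sum_ge R k n.+1 m (fun u => F (lattice_pt A u - g)) r2
    (fun u => F0 _) ur2 hm (fun u i ur => leq_trans (hm2 u i ur)
      (leq_maxr _ _)).
  have -> : \sum_(z : {ffun 'I_k -> 'I_n.+1}) \sum_(z' : {ffun 'I_k -> 'I_n.+1})
     (2 * F (lattice_pt A (cube_pt z - cube_pt z'))
       - F (lattice_pt A (cube_pt z - cube_pt z') + g)
       - F (lattice_pt A (cube_pt z - cube_pt z') - g)) =
     2 * (\sum_(z : {ffun 'I_k -> 'I_n.+1}) \sum_(z' : {ffun 'I_k -> 'I_n.+1})
       F (lattice_pt A (cube_pt z - cube_pt z'))) -
     (\sum_(z : {ffun 'I_k -> 'I_n.+1}) \sum_(z' : {ffun 'I_k -> 'I_n.+1})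
       F (lattice_pt A (cube_pt z - cube_pt z') + g)) -
     (\sum_(z : {ffun 'I_k -> 'I_n.+1}) \sum_(z' : {ffun 'I_k -> 'I_n.+1})
       F (lattice_pt A (cube_pt z - cube_pt z') - g)).
    rewrite mulr_sumr -!sumrB; apply: eq_bigr => z _.
    by rewrite mulr_sumr -!sumrB.
  move=> H; have nk0 : 0 < n.+1%:R ^+ k :> R by rewrite exprn_gt0.
  rewrite -(ler_pM2r nk0).
  have e : (n.+1 - 2 * m)%:R ^+ k =
      (1 - 2 * m%:R * (n.+1%:R)^-1) ^+ k * n.+1%:R ^+ k :> R.
    rewrite -exprMn natrB // natrM; congr (_ ^+ _).
    have : n.+1%:R != 0 :> R by rewrite pnatr_eq0.
    by move: (n.+1%:R) => z z0; field.
  rewrite e in b1 b2.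
  move: H b0 b1 b2; rewrite -/S1 -/S2.
  set x0 := \sum_z _; set x1 := \sum_z _; set x2 := \sum_z _.
  set e1 := (1 - _) ^+ k; set e2 := _ ^+ k.
  move=> H h0 h1 h2.
  have : (2 * U - e1 * (S1 + S2)) * e2 =
    2 * (e2 * U) - (e1 * e2 * S1) - (e1 * e2 * S2) by ring.
  lra.
have cR : 2 * U - (1 - 2 * m%:R * (n.+1%:R)^-1) ^+ k * (S1 + S2) @[n --> \oo]
    --> 2 * U - 1 * (S1 + S2).
  apply: cvgB; first exact: cvg_cst.
  by apply: cvgM; [exact: pow_shrink_cvg|exact: cvg_cst].
have cC : c @[n --> \oo] --> c by exact: cvg_cst.
have : c <= 2 * U - 1 * (S1 + S2); last by lra.
apply: (ler_cvg_to cC cR); near=> n; apply: main.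
  by apply: leqW; near: n; exact: nbhs_infty_ge.
move=> i; apply: (@le_trans _ _ (\sum_j s j)).
  by rewrite (bigD1 i) //= lerDl sumr_ge0 // => j _; exact: ltW.
rewrite -natr1 ler_wpDr //; near: n; exact: nbhs_infty_ger.
Unshelve. all: by end_near.
Qed.

(** * The weights of the class G *)

Lemma Re_fourier {R : realType} (f : R -> R) (xi : R) :
  complex.Re (fourier f xi) = fourier_cos f xi.
Proof.
rewrite /fourier /cintegral /=; apply: eq_Rintegral => x _ /=.
by rewrite mul0r subr0 mulrN cosN mulrA.
Qed.

Lemma Im_fourier {R : realType} (f : R -> R) (xi : R) :
  complex.Im (fourier f xi) = fourier_sin f (- xi).
Proof.
rewrite /fourier /cintegral /=; apply: eq_Rintegral => x _ /=.
by rewrite mul0r addr0 mulrN mulrN !mulNr mulrA.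
Qed.

Lemma classG_pos_fourier_bump {R : realType} (k l : nat) (w : 'I_k -> R -> R) :
  (1 <= l)%N -> classG l w -> forall i,
  [/\ pos_fourier_bump (w i), forall x, 0 <= w i x & 0 < fourier_cos (w i) 0].
Proof.
move=> l1 hw i; have [w0 [wd _] supp wpos wpos0] := hw i.
split => //; last by move: wpos0; rewrite ltcE Re_fourier => /andP[_].
split.
- move=> x; apply: differentiable_continuous; apply/derivable1_diffP.
  exact: (wd 0%N l1).
- move=> x; apply: contraPP => /eqP wx; apply/negP; rewrite -leNgt ler_norml.
  by have := supp x (@subset_closure _ [set x | w i x != 0] x wx);
    rewrite /= in_itv.
- by move=> t; have := wpos t; rewrite lecE Re_fourier => /andP[_].
- move=> t; have := wpos (- t);
  rewrite lecE Im_fourier opprK => /andP[/eqP h _].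
  exact: h.
Qed.

(** * The discrepancy *)

Lemma infinite_nat_unbounded (P : set nat) :
  (forall M, exists N, (M <= N)%N /\ P N) -> infinite_set P.
Proof.
move=> h fP; have [N [hN PN]] := h
  (\max_(x <- finmap.enum_fset (fset_set P)) x).+1.
have NP : N \in finmap.enum_fset (fset_set P) by rewrite in_fset_set // inE.
have := @leq_bigmax_seq _ _ xpredT id N NP isT; rewrite leqNgt => /negP; apply.
exact: hN.
Qed.

(** The integer coordinates of a lattice point in a bounded box are bounded, by
    applying the inverse basis. *)
Lemma finite_lattice_box {R : realType} (k : nat) (B : 'M[R]_k) (T : R) :
  B \in unitmx ->
  finite_set [set v : 'cV[R]_k | lattice B v /\ forall i, `|v i 0| <= T].
Proof.
move=> Bu.
pose K := (Num.truncn (entry_bound (invmx B) * Num.max T 0)).+1.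
pose f (z : {ffun 'I_k -> 'I_(2 * K)}) :=
  lattice_pt B (cube_pt z - const_mx K%:Z).
apply: (@sub_finite_set _ _
  [set` [seq f z | z <- index_enum {ffun 'I_k -> 'I_(2 * K)}]]);
  last exact: finite_seq.
move=> v [[u _ <-] hv] /=.
have T0 : 0 <= Num.max T 0 by rewrite le_max lexx orbT.
have hu i : (absz (u i 0%R) < K)%N.
  rewrite ltnS truncn_ge_nat; last first.
    by rewrite mulr_ge0 // (le_trans _ (entry_bound_ge1 _)).
  have -> : (absz (u i 0%R))%:R = `|(map_mx intr u : 'cV[R]_k) i 0|.
    by rewrite mxE -intr_norm -abszE pmulrn.
  rewrite -(mulKmx Bu (map_mx intr u)) mxE.
  apply: (le_trans (ler_norm_sum _ _ _)).
  apply: (@le_trans _ _ ((\sum_j `|invmx B i j|) * Num.max T 0)); last first.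
    rewrite ler_wpM2r // /entry_bound; apply: ler_wpDr => //.
    rewrite [leRHS](bigD1 i) //= lerDl.
    by apply: sumr_ge0 => j _; apply: sumr_ge0.
  rewrite mulr_suml; apply: ler_sum => j _; rewrite normrM ler_wpM2l //.
  by apply: (le_trans (hv j)); rewrite le_max lexx.
have K0 : (0 < 2 * K)%N by rewrite muln_gt0.
pose z : {ffun 'I_k -> 'I_(2 * K)} :=
  [ffun i => insubd (Ordinal K0) (absz (u i 0%R + K%:Z))].
apply/mapP; exists z; first by rewrite mem_index_enum.
rewrite /f; congr (_ *m map_mx _ _); apply/matrixP => i j.
rewrite !mxE ffunE ord1 val_insubd ifT.
  by rewrite absz_shift // ltnW.
have h := hu i; have := absz_shift_le (u i 0) K _ (ltnSE h).
by rewrite mulSn mul1n => /leq_ltn_trans; apply; rewrite ltn_add2l.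
Qed.

Lemma lift_max_widen (d : nat) (j : 'I_d) :
  lift ord_max j = widen_ord (leqnSn d) j.
Proof. by apply: ord_inj; rewrite /= /bump leqNgt ltn_ord. Qed.

(** The boxes centred at 0, [g] and [- g] have the same volume, so their main
    terms cancel in the second difference, which leaves at most 4 D. *)
Lemma discrepancy_second_diff_ge {R : realType} (d N : nat)
    (w : 'I_d.+1 -> R -> R)
    (A : 'M[R]_d.+1) (g xi : 'cV[R]_d.+1) (s : 'I_d.+1 -> R) (D : R) :
  A \in unitmx ->
  (forall i, pos_fourier_bump (w i)) -> (forall i x, 0 <= w i x) ->
  (0 < N)%N -> s ord_max = N%:R ->
  (forall i : 'I_d, 0 < s (widen_ord (leqnSn d) i) < 1 / 2) ->
  (forall i, `|s i * xi i 0| <= 1 / 32) ->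
  (forall m, exists j : int, \sum_i xi i 0 * lattice_pt A m i 0 = j%:~R) ->
  \sum_i xi i 0 * g i 0 = 1 / 2 ->
  (forall i, `|g i 0| <= 1) -> g ord_max 0 = 0 ->
  (discrepancy w A N <= D%:E)%E ->
  \prod_i (fourier_cos (w i) 0 / (2 * period_cst A)) * (\prod_i s i) <= 4 * D.
Proof.
move=> Au aw w0 N0 sN hs hxi hint hg hg1 gmax hD.
have s0 i : 0 < s i.
  case: (unliftP ord_max i) => [j ->|->]; last by rewrite sN ltr0n.
  rewrite lift_max_widen.
  by case/andP: (hs j).
pose F := scaled_weight w s.
pose rho : 'cV[R]_d := \col_i s (widen_ord (leqnSn d) i).
pose V := constC w * box_vol N rho.
have wE (b v : 'cV[R]_d.+1) : b ord_max 0 = 0 ->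
    box_weight w N (vhead b) rho v = F (v - b).
  move=> b0; rewrite /F /scaled_weight big_ord_recr /= mulrC /box_weight.
  congr (_ * _); first by rewrite sN !mxE b0 subr0.
  by apply: eq_bigr => i _; rewrite !mxE.
have bound (b : 'cV[R]_d.+1) : b ord_max 0 = 0 ->
    (`|\esum_(v in lattice A) (F (v - b))%:E - V%:E| <= D%:E)%E.
  move=> b0; apply: le_trans hD; apply: ereal_sup_ubound.
  exists (vhead b, rho) => /=.
    by move=> i; rewrite mxE; exact: hs.
  rewrite /box_discrepancy (eq_esum (b := fun v => (F (v - b))%:E)) //.
  by move=> v _; rewrite wE.
have ub (b : 'cV[R]_d.+1) : b ord_max 0 = 0 ->
    (\esum_(v in lattice A) (F (v - b))%:E <= (V + D)%:E)%E.
  move=> /bound; case: (esum _ _) => [r| |] //=.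
  by rewrite !lee_fin ler_norml => /andP[_ h]; lra.
have lb (b : 'cV[R]_d.+1) e : 0 < e -> b ord_max 0 = 0 ->
    ((V - D - e)%:E < \esum_(v in lattice A) (F (v - b))%:E)%E.
  move=> e0 /bound; case: (esum _ _) => [r| |] //=.
  by rewrite lee_fin lte_fin ler_norml => /andP[h _]; lra.
apply/ler_addgt0Pr => e e0.
have := @lattice_second_diff_ge R d.+1 w A g xi s (V + D) (V - D - e / 2)
  (V - D - e / 2)
  Au aw w0 s0 hxi hint hg hg1.
have e2 : 0 < e / 2 by rewrite divr_gt0.
have z0 : (0 : 'cV[R]_d.+1) ord_max 0 = 0 by rewrite mxE.
have n0 : (- g) ord_max 0 = 0 by rewrite mxE gmax oppr0.
move=> /(_ _ _ _)/le_trans; apply.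
- by under eq_esum do rewrite -[X in scaled_weight _ _ X]subr0; exact: ub.
- by under eq_esum do rewrite -[X in _ + X]opprK; exact: lb.
- exact: lb.
- lra.
Qed.

Lemma dual_pairing_int {R : realType} (k : nat) (A : 'M[R]_k) (xi : 'cV[R]_k) :
  A \in unitmx -> dual_lattice A xi ->
  forall m, exists j : int, \sum_i xi i 0 * lattice_pt A m i 0 = j%:~R.
Proof.
move=> Au [u _ <-] m; exists (\sum_i u i 0 * m i 0).
have -> : \sum_i ((invmx A)^T *m map_mx intr u) i 0 * lattice_pt A m i 0 =
   (((invmx A)^T *m map_mx intr u)^T *m lattice_pt A m) 0 0.
  by rewrite mxE; apply: eq_bigr => i _; rewrite [in RHS]mxE.
rewrite trmx_mul trmxK -mulmxA mulKmx // mxE rmorph_sum.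
by apply: eq_bigr => i _; rewrite !mxE -intrM.
Qed.

Lemma prod_max1_ge1 {R : realType} (I : finType) (Q : pred I) (a : I -> R) :
  1 <= \prod_(i | Q i) Num.max 1 (a i).
Proof.
apply: (big_ind (fun x => 1 <= x)) => //; first exact: mulr_ege1.
by move=> i _; rewrite le_max lexx.
Qed.

Lemma height_ge1 {R : realType} (d : nat) (m : 'cV[R]_d) : 1 <= height m.
Proof.
exact: prod_max1_ge1.
Qed.

Lemma height_ge_coord {R : realType} (d : nat) (m : 'cV[R]_d) i :
  `|m i 0| <= height m.
Proof.
rewrite /height (bigD1 i) //=.
apply: (@le_trans _ _ (Num.max 1 `|m i 0|)); first by rewrite le_max lexx orbT.
apply: ler_peMr; first by rewrite le_max ler01.
exact: prod_max1_ge1.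
Qed.

Lemma height_gt1 {R : realType} (d : nat) (m : 'cV[R]_d) : 1 < height m ->
  exists i, 1 < `|m i 0|.
Proof.
move=> h; apply: contrapT => hn; move: h; rewrite ltNge => /negP; apply.
rewrite /height big1 // => i _; apply/max_idPl; rewrite leNgt.
by apply/negP => hi; apply: hn; exists i.
Qed.

(** Since phi is at least 1, a solution has last coordinate at most 1, so that
    bounded height would leave only finitely many lattice points. *)
Lemma unbounded_height {R : realType} (d : nat) (A : 'M[R]_d.+1)
    (phi : R -> R) (T : R) :
  A \in unitmx -> (forall x : R, 1 <= x -> 1 <= phi x) ->
  infinite_set [set v : 'cV[R]_d.+1 | dual_lattice A v /\
     `|height (vhead v) * vlast v| < (phi (height (vhead v)))^-1] ->
  exists v : 'cV[R]_d.+1, [/\ dual_lattice A v,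
     `|height (vhead v) * vlast v| < (phi (height (vhead v)))^-1 &
     T < height (vhead v)].
Proof.
move=> Au phi1 inf; apply: contrapT => hn; apply: inf.
have Bu : (invmx A)^T \in unitmx by rewrite unitmx_tr unitmx_inv.
apply: sub_finite_set (finite_lattice_box _ _ (Num.max 1 T) Bu) => v [dv av].
split => // i.
have hT : height (vhead v) <= T.
  by rewrite leNgt; apply/negP => h; apply: hn; exists v.
case: (unliftP ord_max i) => [j ->|->].
  have := height_ge_coord _ (vhead v) j; rewrite mxE.
  rewrite lift_max_widen.
  by move=> h; rewrite le_max (le_trans h hT) orbT.
rewrite le_max; apply/orP; left.
have h1 := height_ge1 _ (vhead v); have p1 := phi1 _ h1.
move: av; rewrite normrM (ger0_norm (_ : 0 <= height _));
  last exact: le_trans h1.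
rewrite /vlast => av.
have : (phi (height (vhead v)))^-1 <= 1.
  by rewrite invf_le1 // (lt_le_trans _ p1).
have := normr_ge0 (v ord_max 0); nra.
Qed.

(** If L x exceeded [H], then x = L x * phi (L x) would exceed [H * phi H]. *)
Lemma Lphi_le {R : realType} (phi : R -> R) (x H : R) :
  (forall x y : R, 1 <= x -> x <= y -> phi x <= phi y) ->
  (forall x : R, 1 <= x -> 1 <= phi x) ->
  (exists H : R, 1 <= H <= x /\ H * phi H = x) ->
  1 <= H -> x <= H * phi H -> phi (Lphi phi x) <= phi H.
Proof.
move=> mono phi1 ex H1 hx.
have [/andP[L1 _] eL] := xgetPex 1 ex; rewrite -/(Lphi phi x) in L1 eL.
rewrite leNgt; apply/negP => hlt.
have HL : H < Lphi phi x.
  by rewrite ltNge; apply/negP => /(mono _ _ L1); rewrite leNgt hlt.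
have : H * phi H < Lphi phi x * phi (Lphi phi x).
  by apply: ltr_pM => //; [exact: le_trans H1|exact: le_trans (phi1 _ H1)].
by rewrite eL ltNge hx.
Qed.

Lemma period_cst_gt0 {R : realType} (k : nat) (A : 'M[R]_k) : 0 < period_cst A.
Proof.
rewrite /period_cst; have := entry_bound_ge1 A; have : 0 <= k%:R :> R by [].
move: (k%:R) (entry_bound A) => x y; nra.
Qed.

(** The sides 1 / (32 max (1, |xi i|)) make all [s i * xi i] at most 1/32, and
    their product is the inverse of the height up to the factor 32 ^ d. The
    shift [g] is carried by a coordinate of [xi] of modulus above 1, so that its
    only entry 1 / (2 xi i) is at most 1. *)
Lemma discrepancy_ge {R : realType} (d N : nat) (w : 'I_d.+1 -> R -> R)
    (A : 'M[R]_d.+1) (xi : 'cV[R]_d.+1) :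
  A \in unitmx ->
  (forall i, pos_fourier_bump (w i)) -> (forall i x, 0 <= w i x) ->
  (forall i, 0 < fourier_cos (w i) 0) -> (0 < N)%N ->
  dual_lattice A xi -> 1 < height (vhead xi) ->
  N%:R * `|vlast xi| <= 1 / 32 ->
  ((\prod_i (fourier_cos (w i) 0 / (2 * period_cst A)) / 32 ^+ d / 4 *
   (N%:R / height (vhead xi)))%:E <= discrepancy w A N)%E.
Proof.
move=> Au aw w0 wpos N0 dxi /height_gt1[i0]; rewrite mxE.
set k0 := widen_ord _ i0 => hi0 hlast.
set c := \prod_i _; set H := height _.
have hint := dual_pairing_int _ _ _ Au dxi.
pose g : 'cV[R]_d.+1 := \col_i (if i == k0 then (2 * xi k0 0)^-1 else 0).
have xi0 : xi k0 0 != 0 by rewrite -normr_gt0 (lt_trans _ hi0).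
have hg : \sum_i xi i 0 * g i 0 = 1 / 2.
  rewrite (bigD1 k0) //= big1 ?addr0 => [|i ik].
    by rewrite mxE eqxx; field.
  by rewrite mxE (negbTE ik) mulr0.
have hg1 i : `|g i 0| <= 1.
  rewrite mxE; case: eqP => _; last by rewrite normr0.
  rewrite normfV normrM (ger0_norm (ler0n _ 2)) invf_le1; last first.
    by rewrite mulr_gt0 // normr_gt0.
  lra.
have gmax : g ord_max 0 = 0.
  rewrite mxE ifF //; apply/eqP => /(congr1 val) /= e.
  by have := ltn_ord i0; lia.
pose s (i : 'I_d.+1) : R :=
  if (i < d)%N then (32 * Num.max 1 `|xi i 0|)^-1 else N%:R.
have sN : s ord_max = N%:R by rewrite /s ltnn.
have m1 i : 1 <= Num.max 1 `|xi i 0| by rewrite le_max lexx.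
have hs i : 0 < s (widen_ord (leqnSn d) i) < 1 / 2.
  rewrite /s /= ltn_ord; have := m1 (widen_ord (leqnSn d) i).
  move: (Num.max _ _) => m hm;
    rewrite invr_gt0 mulr_gt0 ?(lt_le_trans _ hm) //=.
  by rewrite div1r ltf_pV2 ?posrE //; lra.
have hxi i : `|s i * xi i 0| <= 1 / 32.
  rewrite /s; case: ifPn => hi.
    have hm := m1 i; have : `|xi i 0| <= Num.max 1 `|xi i 0| by rewrite le_max
      lexx orbT.
    move: (Num.max _ _) hm => m hm hm2.
    rewrite normrM ger0_norm ?invr_ge0 ?mulr_ge0 //; last lra.
    by rewrite mulrC ler_pdivrMr; lra.
  have -> : i = ord_max.
    by apply/ord_inj/eqP; rewrite eqn_leq -ltnS ltn_ord /= leqNgt.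
  by rewrite normrM normr_nat.
have sprod : \prod_i s i = (32 ^+ d)^-1 * (N%:R / H).
  rewrite big_ord_recr /= sN mulrCA -invfM; rewrite mulrC; congr (_ * _).
  rewrite -[in RHS](card_ord d) -prodr_const /H /height -big_split -prodfV.
  by apply: eq_bigr => i _; rewrite /s /= ltn_ord mxE.
have key D : (discrepancy w A N <= D%:E)%E -> c * (\prod_i s i) <= 4 * D.
  exact: (@discrepancy_second_diff_ge R d N w A g xi s D Au aw w0 N0 sN hs hxi
    hint hg hg1 gmax).
have -> : c / 32 ^+ d / 4 * (N%:R / H) = c * (\prod_i s i) / 4.
  by rewrite sprod; ring.
case e : (discrepancy w A N) => [r| |].
- rewrite lee_fin ler_pdivrMr // (mulrC r); apply: key.
  by rewrite e.
- by rewrite leey.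
- have := key (-1); rewrite e leNye => /(_ isT).
  have : 0 < c * \prod_i s i.
    rewrite mulr_gt0 // prodr_gt0 // => i _; last first.
      case: (unliftP ord_max i) => [j ->|->]; last by rewrite sN ltr0n.
      rewrite lift_max_widen.
      by case/andP: (hs j).
    by rewrite divr_gt0 // mulr_gt0 // period_cst_gt0.
  by move=> h1 h2; exfalso; lra.
Qed.

Theorem theorem1p14 (R : realType) (d l : nat) (hd : (1 <= d)%N)
  (hl : (2 <= l)%N)
  (w : 'I_d.+1 -> R -> R) (hw : classG l w)
  (A : 'M[R]_d.+1) (hA : unimodular_basis A)
  (phi : R -> R)
  (phi_ge1 : forall x : R, 1 <= x -> 1 <= phi x)
  (phi_ndecr : forall x y : R, 1 <= x -> x <= y -> phi x <= phi y)
  (phi_L : forall x : R, phi 1 <= x ->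
     exists H : R, 1 <= H <= x /\ H * phi H = x)
  (approx : infinite_set [set v : 'cV[R]_d.+1 | dual_lattice A v /\
     `|height (vhead v) * vlast v| < (phi (height (vhead v)))^-1]) :
  exists c : R, 0 < c /\
    infinite_set [set N : nat | phi 1 <= N%:R /\
      ((c * phi (Lphi phi N%:R))%:E <= discrepancy w A N)%E].
Proof.
have [Au _] := hA.
have adm := classG_pos_fourier_bump _ _ _ (ltnW hl) hw.
have aw i : pos_fourier_bump (w i) by have [] := adm i.
have w0 i x : 0 <= w i x by have [_ h _] := adm i.
have wpos i : 0 < fourier_cos (w i) 0 by have [] := adm i.
pose c := \prod_i (fourier_cos (w i) 0 / (2 * period_cst A)) / 32 ^+ d / 4.
have c0 : 0 < c.
  rewrite !divr_gt0 // ?exprn_gt0 // prodr_gt0 // => i _.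
  by rewrite divr_gt0 // mulr_gt0 // period_cst_gt0.
exists (c / 64); split; first by rewrite divr_gt0.
apply: infinite_nat_unbounded => M.
have [v [dv av hv]] := unbounded_height _ _ _ (64 * (M%:R + 1)) Au phi_ge1
  approx.
set H := height (vhead v) in av hv.
have M0 : 0 <= M%:R :> R by [].
have H1 : 1 <= H by apply: height_ge1.
have p1 := phi_ge1 _ H1.
have Hp : 64 * (M%:R + 1) <= H * phi H.
  by apply: (le_trans (ltW hv)); rewrite ler_peMr // (le_trans _ H1).
(* N = floor (H phi H / 32) is at least half of H phi H / 32 *)
pose x := H * phi H / 32.
have x0 : 0 <= x by rewrite /x; lra.
pose N := Num.truncn x.
have /andP[N1] := truncn_itv x0; rewrite -/N -(natr1 N) => N2.
have Nx : x / 2 <= N%:R by rewrite /x in N1 N2 *; lra.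
have NH : N%:R <= H * phi H by apply: le_trans N1 _; rewrite /x; lra.
have p1N : phi 1 <= N%:R.
  have := phi_ndecr _ _ (lexx 1) H1.
  have : phi H <= H * phi H / 64.
    by rewrite ler_pdivlMr // mulrC ler_wpM2r //; lra.
  by rewrite /x in Nx; lra.
exists N; split; last split => //.
  by rewrite -(ler_nat R); rewrite /x in Nx; lra.
apply: le_trans (discrepancy_ge _ _ _ _ _ Au aw w0 wpos _ dv _ _).
- rewrite lee_fin -/c -/H -mulrA; apply: ler_wpM2l; first exact: ltW.
  have := Lphi_le _ _ _ phi_ndecr phi_ge1 (phi_L _ p1N) H1 NH.
  have : phi H / 64 <= N%:R / H.
    rewrite ler_pdivlMr ?(lt_le_trans _ H1) //.
    by apply: le_trans Nx; rewrite /x; lra.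
  lra.
- by rewrite truncn_gt0 /x; lra.
- by rewrite -/H; lra.
- have : N%:R * `|vlast v| <= x * `|vlast v| by rewrite ler_wpM2r.
  move: av; rewrite normrM (ger0_norm (_ : 0 <= H)); last lra.
  rewrite -div1r ltr_pdivlMr; last lra.
  by rewrite /x => h1 h2; lra.
Qed.
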